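(* Let $n\ge1$, $a>0$ and $s>0$. There is a constant $C$, depending only on $n$, $a$ and $s$, such that for every (nonempty) bounded set $E\subset\mathbb{R}$ and every $f\in\mathscr{S}(\mathbb{R}^n)$, $$\int_{\mathbb{R}^n}|S^*f(x)|^2\,dx\le C\left(\sum_{m=0}^\infty N_E(2^{-m})\,2^{-2ms/a}\right)\|f\|_{H_s}^2,$$ where $S^*f(x)=\sup_{t\in E}|S_tf(x)|$ for $x\in\mathbb{R}^n$.
   Context: $\mathscr{S}(\mathbb{R}^n)$ is the Schwartz class. The Fourier transform is $\hat f(\xi)=\int_{\mathbb{R}^n}e^{-i\xi\cdot x}f(x)\,dx$. For $t\in\mathbb{R}$, $S_tf(x)=(2\pi)^{-n}\int_{\mathbb{R}^n}e^{i\xi\cdot x}e^{it|\xi|^a}\hat f(\xi)\,d\xi$. The Sobolev norm is $\|f\|_{H_s}=\left(\int_{\mathbb{R}^n}(1+|\xi|^2)^s|\hat f(\xi)|^2\,d\xi\right)^{1/2}$. For a bounded set $E\subset\mathbb{R}$ and $r>0$, $N_E(r)$ denotes the minimal number $N$ of intervals $I_1,\dots,I_N$ of length $r$ such that $E\subset\bigcup_{l=1}^N I_l$. *)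

(* Defs.v *)
From HB Require Import structures.
From mathcomp Require Import all_boot all_order all_algebra.
From mathcomp Require Import complex.
From mathcomp Require Import all_classical all_reals all_analysis.

Set Implicit Arguments.
Unset Strict Implicit.
Unset Printing Implicit Defensive.

Import Order.TTheory GRing.Theory Num.Theory.
Import numFieldNormedType.Exports.

Local Open Scope classical_set_scope.
Local Open Scope ring_scope.

Definition rV_display : measure_display.
Proof. exact. Qed.

(* The sigma-algebra on R^n generated by the coordinate functions, i.e. the
   Borel sigma-algebra (same construction as the library's for n-tuples). *)
Section measurable_rV.
Variables (R : realType) (n : nat).

Let coord (i : 'I_n) (x : 'rV[R]_n) : measurableTypeR R := x ord0 i.

Let rV_set0 : g_sigma_preimage coord set0.
Proof. exact: sigma_algebra0. Qed.

Let rV_setC A : g_sigma_preimage coord A -> g_sigma_preimage coord (~` A).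
Proof. exact: sigma_algebraC. Qed.

Let rV_bigcup (F : (set 'rV[R]_n)^nat) :
  (forall i, g_sigma_preimage coord (F i)) ->
  g_sigma_preimage coord (\bigcup_i (F i)).
Proof. exact: sigma_algebra_bigcup. Qed.

HB.instance Definition _ := @isMeasurable.Build rV_display
  'rV[R]_n (g_sigma_preimage coord) rV_set0 rV_setC rV_bigcup.

Lemma measurable_coord (i : 'I_n) :
  measurable_fun [set: 'rV[R]_n] (fun x => x ord0 i : measurableTypeR R).
Proof.
move=> _ Y mY; rewrite setTI; apply: sub_sigma_algebra => /=.
rewrite -bigcup_seq/=; exists i => /=; first by rewrite mem_index_enum.
by exists Y => //; rewrite setTI.
Qed.

Lemma measurable_fun_rVP d (T : measurableType d) (f : T -> 'rV[R]_n) :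
  measurable_fun [set: T] f <->
  forall i, measurable_fun [set: T] (fun t => f t ord0 i : measurableTypeR R).
Proof.
split=> [mf i|mf].
  exact: (measurableT_comp (measurable_coord i) mf).
have : g_sigma_preimage (fun i => coord i \o f) `<=` measurable.
  apply: smallest_sub; first exact: sigma_algebra_measurable.
  elim/big_ind: _ => // [A B AU BU|i _ _ [B mB <-]]; last exact: mf.
  by move=> C [/AU|/BU].
rewrite g_sigma_preimage_comp => prefS _ A mA.
by apply: prefS; exists A.
Qed.

End measurable_rV.

Section lebesgue_rV.
Variable R : realType.

Definition rV_cons n (p : measurableTypeR R * 'rV[R]_n) : 'rV[R]_n.+1 :=
  row_mx (p.1 : R)%:M p.2.

Lemma rV_cons0 n p : @rV_cons n p ord0 ord0 = p.1.
Proof.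
have -> : (ord0 : 'I_n.+1) = lshift n (ord0 : 'I_1) by exact/val_inj.
by rewrite /rV_cons (@row_mxEl _ _ 1) mxE eqxx.
Qed.

Lemma rV_cons_lift n p (i : 'I_n) : rV_cons p ord0 (lift ord0 i) = p.2 ord0 i.
Proof. by rewrite /rV_cons -rshift1 (@row_mxEr _ _ 1). Qed.

Lemma measurable_rV_cons n : measurable_fun [set: _] (@rV_cons n).
Proof.
apply/measurable_fun_rVP => i; case: (unliftP ord0 i) => [j ->|->].
  under eq_fun do rewrite rV_cons_lift.
  exact: (measurableT_comp (measurable_coord j) measurable_snd).
under eq_fun do rewrite rV_cons0.
exact: measurable_fst.
Qed.

Definition rV_uncons n (x : 'rV[R]_n.+1) : measurableTypeR R * 'rV[R]_n :=
  (x ord0 ord0, \row_i x ord0 (lift ord0 i)).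

Lemma rV_consK n : cancel (@rV_cons n) (@rV_uncons n).
Proof.
move=> [a v]; rewrite /rV_uncons rV_cons0; congr pair.
by apply/rowP => i; rewrite mxE rV_cons_lift.
Qed.

Lemma measurable_rV_uncons n : measurable_fun [set: _] (@rV_uncons n).
Proof.
apply/measurable_fun_pairP; split; first exact: measurable_coord.
apply/measurable_fun_rVP => i.
under eq_fun do rewrite mxE.
exact: measurable_coord.
Qed.

Section step.
Variables (n : nat) (mu : {sigma_finite_measure set 'rV[R]_n -> \bar R}).

Let prod : {measure set (measurableTypeR R * 'rV[R]_n) -> \bar R} :=
  (lebesgue_measure \x mu)%E.

Definition lebesgue_rV_cons : set 'rV[R]_n.+1 -> \bar R :=
  pushforward (lebesgue_measure \x mu)%E (@rV_cons n).

HB.instance Definition _ := Measure.copy lebesgue_rV_cons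
  (measure_function_pushforward__canonical__measure_function_Measure
    prod (@measurable_rV_cons n)).

Let sigma_finite_cons : sigma_finite setT lebesgue_rV_cons.
Proof.
have /sigma_finiteP[F [TF ndF Foo]] := sigma_finiteT (@lebesgue_measure R).
have /sigma_finiteP[G [TG ndG Goo]] := sigma_finiteT mu.
exists (fun k => @rV_uncons n @^-1` (F k `*` G k)).
  rewrite -preimage_bigcup (_ : \bigcup_k _ = setT) ?preimage_setT//.
  apply/seteqP; split=> // -[a v] _.
  have : setT a by []. rewrite TF => -[i _ Fia].
  have : setT v by []. rewrite TG => -[j _ Gjv].
  exists (maxn i j) => //; split.
    by move: a Fia; exact/subsetPset/ndF/leq_maxl.
  by move: v Gjv; exact/subsetPset/ndG/leq_maxr.
move=> k; have [? ?] := Foo k; have [? ?] := Goo k; split.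
  rewrite -[X in measurable X]setTI; apply: measurable_rV_uncons => //.
  exact: measurableX.
rewrite /lebesgue_rV_cons /pushforward -comp_preimage.
rewrite (_ : _ \o _ = id); last by apply/funext; exact: rV_consK.
by rewrite preimage_id product_measure1E// lte_mul_pinfty// ge0_fin_numE.
Qed.

HB.instance Definition _ := Measure_isSigmaFinite.Build _ _ _
  lebesgue_rV_cons sigma_finite_cons.
End step.

(* Lebesgue measure on R^n, as the n-fold product of Lebesgue measure on R;
   the unit point mass when n = 0. *)
Fixpoint lebesgue_rV (n : nat) :
    {sigma_finite_measure set 'rV[R]_n -> \bar R} :=
  match n with
  | 0 => \d_(0 : 'rV[R]_0)
  | n'.+1 => lebesgue_rV_cons (lebesgue_rV n')
  end.

Lemma lebesgue_rV_box n (A : 'I_n -> set (measurableTypeR R)) :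
  (forall i, measurable (A i)) ->
  (lebesgue_rV n [set x | forall i, A i (x ord0 i)] =
   \prod_(i < n) lebesgue_measure (A i))%E.
Proof.
elim: n A => [|n IHn] A mA.
  by rewrite big_ord0 /= diracE mem_set// => -[].
have mB : measurable
    [set x : 'rV[R]_n | forall i, A (lift ord0 i) (x ord0 i)].
  rewrite (_ : [set x | _] = \bigcap_(i in [set: 'I_n])
    ((fun x : 'rV[R]_n => x ord0 i) @^-1` A (lift ord0 i))).
    apply: fin_bigcap_measurable => // i _.
    by rewrite -[X in measurable X]setTI; exact: measurable_coord.
  by apply/seteqP; split=> x /= Ax i; [move=> _|]; exact: Ax.
rewrite big_ord_recl -IHn //= /lebesgue_rV_cons /pushforward.
rewrite -product_measure1E//; congr (_ _).
apply/seteqP; split=> -[a v] /= Av.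
  split; first by have := Av ord0; rewrite rV_cons0.
  by move=> i; have := Av (lift ord0 i); rewrite rV_cons_lift.
case: Av => Aa Av i.
by case: (unliftP ord0 i) => [j ->|->]; rewrite ?rV_cons_lift ?rV_cons0.
Qed.

End lebesgue_rV.

Section schroedinger.
Variables (R : realType) (n : nat).
Implicit Types (f : 'rV[R]_n -> R[i]) (g : 'rV[R]_n -> R) (x xi : 'rV[R]_n).

Definition partial (i : 'I_n) g x : R := 'D_(delta_mx ord0 i) g x.

Definition partials (l : seq 'I_n) g : 'rV[R]_n -> R := foldr partial g l.

(* Derivatives are indexed by words in the coordinates rather than by
   multi-indices: for smooth g the partial derivatives commute. *)
Definition real_schwartz g : Prop :=
  (forall l x, differentiable (partials l g) x) /\
  (forall (alpha : 'I_n -> nat) l, exists M : R, forall x,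
     `|(\prod_(i < n) x ord0 i ^+ alpha i) * partials l g x| <= M).

Definition schwartz f : Prop :=
  real_schwartz (fun x => complex.Re (f x)) /\
  real_schwartz (fun x => complex.Im (f x)).

Definition dotv x xi : R := \sum_(i < n) x ord0 i * xi ord0 i.

(* The library norm on 'rV[R]_n is the sup norm, not the Euclidean one. *)
Definition enorm x : R := Num.sqrt (dotv x x).

Definition expi (theta : R) : R[i] := (cos theta +i* sin theta)%C.

Definition modulus (z : R[i]) : R := complex.Re `|z|.

Definition integralC f : R[i] :=
  ((\int[lebesgue_rV R n]_x complex.Re (f x)) +i*
   (\int[lebesgue_rV R n]_x complex.Im (f x)))%C.

Definition fourier f xi : R[i] :=
  integralC (fun x => expi (- dotv xi x) * f x).

Definition propagator (a t : R) f x : R[i] :=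
  ((2 * pi) ^- n)%:C%C *
  integralC (fun xi => expi (dotv xi x) * expi (t * enorm xi `^ a) *
                       fourier f xi).

(* sup over t in E of |S_t f(x)|, in the extended reals (-oo if E is empty). *)
Definition maximal_propagator (a : R) (E : set R) f x : \bar R :=
  ereal_sup [set (modulus (propagator a t f x))%:E | t in E].

Definition sobolev_norm (s : R) f : \bar R :=
  ((\int[lebesgue_rV R n]_xi
     ((1 + enorm xi ^+ 2) `^ s * modulus (fourier f xi) ^+ 2)%:E) `^ 2^-1)%E.

End schroedinger.

Section covering_number.
Variable R : realType.

(* An interval of length r, with each endpoint either included or excluded. *)
Definition interval_of_length (r : R) (I : set R) : Prop :=
  exists (c : R) (bl br : bool),
    I = [set` Interval (BSide bl c) (BSide br (c + r))].

Definition coverable (E : set R) (r : R) (N : nat) : Prop :=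
  exists I : 'I_N -> set R,
    (forall l, interval_of_length r (I l)) /\ E `<=` \bigcup_l I l.

(* N_E(r), as a minimum in the extended reals; it is finite for bounded E and
   r > 0. *)
Definition covering_number (E : set R) (r : R) : \bar R :=
  ereal_inf [set (N%:R)%:E | N in coverable E r].

End covering_number.

(* Main.v *)
Require Import Defs.
From HB Require Import structures.
From mathcomp Require Import all_boot all_order all_algebra.
From mathcomp Require Import complex.
From mathcomp Require Import all_classical all_reals all_analysis.
From mathcomp Require Import measurable_realfun ring lra.

(** The frequency space is cut into annuli on which |xi|^a is at most 2^m.  If
    g lives on such an annulus and J is an interval of length 2^-m, then for t
    in J the function S_t g differs from S_(t0) g by the integral over a part of
    J of functions whose L^2 norms are at most 2^m times that of g; by
    Cauchy-Schwarz in time and the Bessel inequality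
    ||int cos(x.y + c) g(y) dy||_2 <= C ||g||_2, the maximal function over J has
    L^2 norm at most C ||g||_2.  Covering E by N_E(2^-m) such intervals and
    summing over m with Cauchy-Schwarz, with weights N_E(2^-m) 2^(-2ms/a),
    gives the estimate.

    No Plancherel theorem or decay of the Fourier transform is needed: the
    Bessel inequality is proved directly for bounded g supported in a box (on
    the line by a Schur test for the kernel of the weight 1 - x^2/k^2, then by
    induction on the dimension), and a divergent inversion integral is 0 by
    convention, so truncation and Fatou's lemma suffice. *)

Set Implicit Arguments.
Unset Strict Implicit.
Unset Printing Implicit Defensive.

Import Order.TTheory GRing.Theory Num.Theory.
Import numFieldNormedType.Exports.

Local Open Scope classical_set_scope.
Local Open Scope ring_scope.

(** * Iterated real integrals *)

(** Everything is done with real cosines: a complex exponential becomes [cos] with an arbitrary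
    constant phase, the sine being the phase -pi/2. Each use of an addition formula then costs a
    factor of at most 4, through (A - B)^2 <= 2 A^2 + 2 B^2. Two requirements shape the statements.
    The constant of the Bessel inequality may depend on the dimension only, never on the box or on a
    bound for g: otherwise the truncations could not be removed in the limit. And E may be
    uncountable, so no step relies on a supremum over E being measurable: such a supremum is carried
    by a measurable majorant of the squares, and these majorants can be added over unions and sums
    and passed to the limit. Infinite values also matter. The series may diverge while the Sobolev
    norm vanishes, and the product is then 0, so a zero Fourier transform needs an argument of its
    own. *)

Section measurable_trigo.
Context d (T : measurableType d) (R : realType).
Implicit Types f g : T -> R.

Lemma measurable_fun_cos f : measurable_fun setT f ->
  measurable_fun setT (fun x => cos (f x)).
Proof.
exact: (measurableT_comp (continuous_measurable_fun (@continuous_cos R))).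
Qed.

Lemma measurable_fun_sin f : measurable_fun setT f ->
  measurable_fun setT (fun x => sin (f x)).
Proof.
exact: (measurableT_comp (continuous_measurable_fun (@continuous_sin R))).
Qed.

End measurable_trigo.

Ltac measurability := repeat
  first [ assumption | exact: measurable_cst | exact: measurable_id
        | exact: measurable_fst | exact: measurable_snd
        | apply: measurable_fun_cos | apply: measurable_fun_sin
        | apply: measurable_funM | apply: measurable_funD
        | apply: measurable_funB | apply: measurable_funX
        | apply: measurableT_comp => //
        ].

Section dominated_real_integrals.
Context d (T : measurableType d) (R : realType).
Variable mu : {measure set T -> \bar R}.
Implicit Types f g p : T -> R.

Lemma dom_integrable f p : measurable_fun setT f ->
  mu.-integrable setT (EFin \o p) -> (forall x, `|f x| <= p x) ->
  mu.-integrable setT (EFin \o f).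
Proof.
move=> mf ip fp; apply: le_integrable ip => //.
  exact/measurable_EFinP.
move=> x _ /=; rewrite lee_fin; apply: le_trans (fp x) _; exact: ler_norm.
Qed.

Lemma integrable_Rscale k f : mu.-integrable setT (EFin \o f) ->
  mu.-integrable setT (EFin \o (fun x => k * f x)).
Proof. exact: (integrableZl measurableT k). Qed.

Lemma EFin_Rintegral f : mu.-integrable setT (EFin \o f) ->
  (\int[mu]_x f x)%:E = (\int[mu]_x (f x)%:E)%E.
Proof. by move=> fi; rewrite /Rintegral fineK//; exact: integrable_fin_num. Qed.

Lemma norm_Rintegral_le f p : measurable_fun setT f ->
  mu.-integrable setT (EFin \o p) -> (forall x, `|f x| <= p x) ->
  `|\int[mu]_x f x| <= \int[mu]_x p x.
Proof.
move=> mf ip fp; have fi := dom_integrable mf ip fp.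
apply: le_trans (le_normr_Rintegral measurableT fi) _.
apply: le_Rintegral => //.
exact: (integrable_norm fi).
Qed.

Lemma ge0_integral_le (f g : T -> \bar R) : measurable_fun setT f ->
  measurable_fun setT g -> (forall x, 0 <= f x)%E -> (forall x, f x <= g x)%E ->
  (\int[mu]_x f x <= \int[mu]_x g x)%E.
Proof. by move=> mf mg f0 fg; apply: ge0_le_integral. Qed.

(* The integral of a nonnegative function, measurable or not, is the supremum
   of the integrals of the simple functions below it. *)
Lemma ge0_nonmeasurable_integral_le (f g : T -> \bar R) :
  (forall x, 0 <= f x)%E -> (forall x, f x <= g x)%E ->
  (\int[mu]_x f x <= \int[mu]_x g x)%E.
Proof.
move=> f0 fg.
rewrite !ge0_integralTE//; last by move=> x; exact: le_trans (f0 x) (fg x).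
apply: le_ereal_sup => _ [h /= hf <-]; exists h => // x /=.
exact: le_trans (hf x) (fg x).
Qed.

End dominated_real_integrals.

Section iterated_real_integrals.
Context d1 d2 (X : measurableType d1) (Y : measurableType d2) (R : realType).
Implicit Types F : X -> Y -> R.

Definition jointly_measurable F := measurable_fun setT (fun z => F z.1 z.2).

Lemma jointly_measurable1 F x : jointly_measurable F -> measurable_fun setT (F x).
Proof. move=> mF; exact: (measurableT_comp mF (measurable_pair1 x)). Qed.

Lemma jointly_measurable2 F y : jointly_measurable F ->
  measurable_fun setT (F^~ y).
Proof. move=> mF; exact: (measurableT_comp mF (measurable_pair2 y)). Qed.

Lemma measurable_joint_comp d (T : measurableType d) F (f : T -> X) (g : T -> Y) :
  jointly_measurable F -> measurable_fun setT f -> measurable_fun setT g ->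
  measurable_fun setT (fun t => F (f t) (g t)).
Proof.
move=> mF mf mg.
exact: (measurableT_comp mF (measurable_fun_pair mf mg)).
Qed.

(** No integrability is assumed: the integrals of the positive and negative parts are measurable in
    x by Tonelli, and [fine] gives a real value where their difference is infinite. Fourier
    transforms and oscillatory integrals get their measurability from this. *)
Lemma measurable_Rintegral (nu : {sigma_finite_measure set Y -> \bar R}) F :
  jointly_measurable F -> measurable_fun setT (fun x => \int[nu]_y F x y).
Proof.
move=> mF; rewrite /Rintegral.
apply: (measurableT_comp (fine_measurable measurableT)) => //.
under eq_fun do rewrite integralE.
pose G := EFin \o (fun z : X * Y => F z.1 z.2).
have mG : measurable_fun setT G by exact/measurable_EFinP.
apply: emeasurable_funB.
- have mp : measurable_fun setT G^\+%E by exact: measurable_funepos.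
  have := measurable_fun_fubini_tonelli_F (m2 := nu) _ mp (fun=> funepos_ge0 _ _).
  congr measurable_fun; apply/funext => x; apply: eq_integral => y _.
  by rewrite !funeposE.
- have mn : measurable_fun setT G^\-%E by exact: measurable_funeneg.
  have := measurable_fun_fubini_tonelli_F (m2 := nu) _ mn (fun=> funeneg_ge0 _ _).
  congr measurable_fun; apply/funext => x; apply: eq_integral => y _.
  by rewrite !funenegE.
Qed.

Variables (mu : {sigma_finite_measure set X -> \bar R}).
Variables (nu : {sigma_finite_measure set Y -> \bar R}).

Lemma ge0_measurable_integral (F : X -> Y -> \bar R) :
  measurable_fun setT (fun z => F z.1 z.2) -> (forall x y, 0 <= F x y)%E ->
  measurable_fun setT (fun x => \int[nu]_y F x y)%E.
Proof.
by move=> mF F0; apply: (measurable_fun_fubini_tonelli_F (fun z => F z.1 z.2)).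
Qed.

Lemma ge0_measurable_integral2 (F : X -> Y -> \bar R) :
  measurable_fun setT (fun z => F z.1 z.2) -> (forall x y, 0 <= F x y)%E ->
  measurable_fun setT (fun y => \int[mu]_x F x y)%E.
Proof.
by move=> mF F0; apply: (measurable_fun_fubini_tonelli_G (fun z => F z.1 z.2)).
Qed.

Lemma tonelli_swap (F : X -> Y -> \bar R) :
  measurable_fun setT (fun z => F z.1 z.2) -> (forall x y, 0 <= F x y)%E ->
  (\int[mu]_x \int[nu]_y F x y = \int[nu]_y \int[mu]_x F x y)%E.
Proof.
by move=> mF F0; apply: (fubini_tonelli (fun z => F z.1 z.2)).
Qed.

Lemma integrable_tensor (p : X -> R) (q : Y -> R) :
  mu.-integrable setT (EFin \o p) -> nu.-integrable setT (EFin \o q) ->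
  (mu \x nu)%E.-integrable setT (EFin \o (fun z => p z.1 * q z.2)).
Proof.
move=> ip iq; have [[mp ip'] [mq iq']] := (integrableP _ _ _ ip, integrableP _ _ _ iq).
have mp1 : measurable_fun setT p by exact/measurable_EFinP.
have mq1 : measurable_fun setT q by exact/measurable_EFinP.
apply/integrable12ltyP.
  by apply/measurable_EFinP; measurability.
rewrite /=.
under eq_integral => x _.
  under eq_integral => y _ do rewrite normrM EFinM.
  rewrite ge0_integralZl//; last first.
    by apply/measurable_EFinP; exact: (measurableT_comp (@normr_measurable _ setT)).
  over.
rewrite ge0_integralZr//; last 2 first.
  by apply/measurable_EFinP; exact: (measurableT_comp (@normr_measurable _ setT)).
  exact: integral_ge0.
by rewrite lte_mul_pinfty// ?integral_ge0// ge0_fin_numE// integral_ge0.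
Qed.

Section rfubini.
Variables (F : X -> Y -> R) (p : X -> R) (q : Y -> R).
Hypotheses (mF : jointly_measurable F).
Hypotheses (ip : mu.-integrable setT (EFin \o p)).
Hypotheses (iq : nu.-integrable setT (EFin \o q)).
Hypotheses (Fpq : forall x y, `|F x y| <= p x * q y).

(** A tensor majorant gives integrability on the product and on every section, not only on almost
    every one, so the inner integrals are finite at each point. *)
Lemma rfubini_integrable :
  (mu \x nu)%E.-integrable setT (EFin \o (fun z => F z.1 z.2)).
Proof. by apply: dom_integrable (integrable_tensor ip iq) _. Qed.

Lemma rfubini_integrable1 x : nu.-integrable setT (EFin \o F x).
Proof.
apply: (@dom_integrable _ _ _ _ _ (fun y => p x * q y)) => //.
  exact: jointly_measurable1.
exact: (integrableZl measurableT (p x) iq).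
Qed.

Lemma rfubini_integrable2 y : mu.-integrable setT (EFin \o F^~ y).
Proof.
apply: (@dom_integrable _ _ _ _ _ (fun x => p x * q y)) => //.
  exact: jointly_measurable2.
exact: (integrableZr measurableT (q y) ip).
Qed.

Lemma rfubini_prod1 :
  \int[(mu \x nu)%E]_z F z.1 z.2 = \int[mu]_x \int[nu]_y F x y.
Proof.
rewrite {1}/Rintegral -integral12_prod_meas1; last exact: rfubini_integrable.
congr fine; apply: eq_integral => x _.
by rewrite EFin_Rintegral//; exact: rfubini_integrable1.
Qed.

Lemma rfubini_prod2 :
  \int[(mu \x nu)%E]_z F z.1 z.2 = \int[nu]_y \int[mu]_x F x y.
Proof.
rewrite {1}/Rintegral -integral21_prod_meas1; last exact: rfubini_integrable.
congr fine; apply: eq_integral => x _.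
by rewrite EFin_Rintegral//; exact: rfubini_integrable2.
Qed.

Lemma rfubini : \int[mu]_x \int[nu]_y F x y = \int[nu]_y \int[mu]_x F x y.
Proof. by rewrite -rfubini_prod1 rfubini_prod2. Qed.

End rfubini.

End iterated_real_integrals.

(** * Oscillatory integrals and the Bessel inequality *)

Section oscillatory_integrals.
Context d1 d2 (X : measurableType d1) (Y : measurableType d2) (R : realType).
Variables (mu : {measure set X -> \bar R}).
Variables (nu : {measure set Y -> \bar R}).
Implicit Types (phi : X -> Y -> R) (theta b g h : Y -> R).

(** Stands for the indicator of a box. These three properties are stable under tensor products, as
    the induction on the dimension needs. *)
Definition window b := [/\ measurable_fun setT b,
  nu.-integrable setT (EFin \o b) & forall y, 0 <= b y <= 1].

(** When [b] is the indicator of a box: bounded and supported in it. [L] is hidden by the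
    existential because no final constant may depend on it. *)
Definition tame b g :=
  measurable_fun setT g /\ exists L, forall y, `|g y| <= L * b y.

(** Real form of an oscillatory integral with kernel e^(i phi): the constant phases 0 and -pi/2 give
    its cosine and sine transforms. *)
Definition osc phi theta g (x : X) : R :=
  \int[nu]_y (cos (phi x y + theta y) * g y).

(** All constant phases are included because addition formulas turn one phase into others; [C] is
    uniform in [g] and [c]. *)
Definition bessel phi b (C : R) := forall g c, tame b g ->
  (\int[mu]_x (osc phi (cst c) g x ^+ 2)%:E <=
   C%:E * \int[nu]_y (g y ^+ 2)%:E)%E.

Lemma tame_measurable b g : tame b g -> measurable_fun setT g.
Proof. by case. Qed.

Lemma tame_integrable b g : window b -> tame b g ->
  nu.-integrable setT (EFin \o g).
Proof.
move=> [mb ib _] [mg [L gL]]; apply: dom_integrable mg _ gL.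
exact: (integrableZl measurableT L ib).
Qed.

Lemma tameM b g h M : window b -> tame b g -> measurable_fun setT h ->
  (forall y, `|h y| <= M) -> tame b (fun y => h y * g y).
Proof.
move=> [_ _ b01] [mg [L gL]] mh hM; split; first by measurability.
exists (M * L) => y; rewrite normrM -mulrA; apply: ler_pM => //.
Qed.

Lemma osc_integrable phi theta b g x : window b -> tame b g ->
  jointly_measurable phi -> measurable_fun setT theta ->
  nu.-integrable setT (EFin \o (fun y => cos (phi x y + theta y) * g y)).
Proof.
move=> wb tg mphi mtheta; apply: (tame_integrable wb).
apply: (tameM (M := 1) wb tg) => //.
  by apply: measurable_fun_cos; apply: measurable_funD => //;
    exact: jointly_measurable1.
by move=> y; exact: cos_max.
Qed.

(** Addition formula with sin A = cos (A - pi/2): a phase depending on y is traded for bounded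
    factors multiplying [g], at the price of two terms. *)
Lemma osc_phaseD phi theta1 theta2 b g x : window b -> tame b g ->
  jointly_measurable phi -> measurable_fun setT theta1 ->
  measurable_fun setT theta2 ->
  osc phi (theta1 \+ theta2) g x =
  osc phi theta1 (fun y => cos (theta2 y) * g y) x -
  osc phi (theta1 \+ cst (- (pi / 2))) (fun y => sin (theta2 y) * g y) x.
Proof.
move=> wb tg mphi mt1 mt2; rewrite /osc -RintegralB //.
- apply: eq_Rintegral => y _ /=.
  rewrite (addrA (phi x y) (theta1 y) (theta2 y)).
  rewrite (addrA (phi x y) (theta1 y) (- (pi / 2))) cosBpihalf.
  by rewrite (cosD (phi x y + theta1 y) (theta2 y)) mulrBl -!mulrA.
- apply: (@osc_integrable _ _ b) => //; apply: (tameM (M := 1) wb tg) => //.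
    exact: measurable_fun_cos.
  by move=> y; exact: cos_max.
- apply: (@osc_integrable _ _ b) => //; last exact: measurable_funD.
  apply: (tameM (M := 1) wb tg) => //.
    exact: measurable_fun_sin.
  by move=> y; exact: sin_max.
Qed.

Lemma integral_sqrB_le (f g : X -> R) : measurable_fun setT f ->
  measurable_fun setT g ->
  (\int[mu]_x ((f x - g x) ^+ 2)%:E <= 2%:E * \int[mu]_x (f x ^+ 2)%:E +
    2%:E * \int[mu]_x (g x ^+ 2)%:E)%E.
Proof.
move=> mf mg.
have mf2 : measurable_fun setT (fun x => (f x ^+ 2)%:E).
  by apply/measurable_EFinP; exact: measurable_funX.
have mg2 : measurable_fun setT (fun x => (g x ^+ 2)%:E).
  by apply/measurable_EFinP; exact: measurable_funX.
have sq0 (z : R) : (0 <= (z ^+ 2)%:E)%E by rewrite lee_fin sqr_ge0.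
rewrite -!ge0_integralZl_EFin// -ge0_integralD//; first last.
- exact: measurable_funeM.
- by move=> x _; rewrite mule_ge0.
- exact: measurable_funeM.
- by move=> x _; rewrite mule_ge0.
apply: ge0_integral_le => //.
- by apply/measurable_EFinP; apply: measurable_funX; exact: measurable_funB.
- by apply: emeasurable_funD; exact: measurable_funeM.
- move=> x; rewrite -!EFinM -EFinD lee_fin.
  have := sqr_ge0 (f x + g x); nra.
Qed.

End oscillatory_integrals.

Section bessel_phase.
Context d1 d2 (X : measurableType d1) (Y : measurableType d2) (R : realType).
Variables (mu : {measure set X -> \bar R}).
Variables (nu : {sigma_finite_measure set Y -> \bar R}).
Implicit Types (phi : X -> Y -> R) (theta b g h : Y -> R).

Lemma measurable_osc phi theta g : jointly_measurable phi ->
  measurable_fun setT theta -> measurable_fun setT g ->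
  measurable_fun setT (osc nu phi theta g).
Proof.
move=> mphi mtheta mg.
apply: (@measurable_Rintegral _ _ _ _ _ nu
  (fun x y => cos (phi x y + theta y) * g y)).
apply: measurable_funM; last exact: measurableT_comp mg measurable_snd.
apply: measurable_fun_cos; apply: measurable_funD; first exact: mphi.
exact: measurableT_comp mtheta measurable_snd.
Qed.

(** Applied to theta = t lam + c, it makes the bound uniform in the time t. The 4 is 2 + 2: the
    square of a difference of two terms, in which |cos theta| and |sin theta| are bounded by 1. *)
Lemma bessel_phase phi theta b g C : 0 <= C -> window nu b -> tame b g ->
  jointly_measurable phi -> measurable_fun setT theta -> bessel mu nu phi b C ->
  (\int[mu]_x (osc nu phi theta g x ^+ 2)%:E <=
   (4 * C)%:E * \int[nu]_y (g y ^+ 2)%:E)%E.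
Proof.
move=> C0 wb tg mphi mt B; have mg := tame_measurable tg.
have tc : tame b (fun y => cos (theta y) * g y).
  apply: (tameM (M := 1) wb tg) => //; first exact: measurable_fun_cos.
  by move=> y; exact: cos_max.
have ts : tame b (fun y => sin (theta y) * g y).
  apply: (tameM (M := 1) wb tg) => //; first exact: measurable_fun_sin.
  by move=> y; exact: sin_max.
have sq0 (z : R) : (0 <= (z ^+ 2)%:E)%E by rewrite lee_fin sqr_ge0.
have E x : osc nu phi theta g x = osc nu phi (cst 0) (fun y => cos (theta y) * g y) x -
    osc nu phi (cst (- (pi / 2))) (fun y => sin (theta y) * g y) x.
  rewrite [in LHS](_ : theta = cst 0 \+ theta); last first.
    by apply/funext => y /=; rewrite add0r.
  rewrite (osc_phaseD x wb tg mphi _ mt)//; congr (_ - osc _ _ _ _).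
  by apply/funext => y /=; rewrite add0r.
under eq_integral => x _ do rewrite E.
apply: le_trans (integral_sqrB_le _ _ _) _.
- by apply: measurable_osc => //; exact: tame_measurable tc.
- by apply: measurable_osc => //; exact: tame_measurable ts.
have le_g2 (h : Y -> R) : tame b (fun y => h y * g y) ->
    (forall y, `|h y| <= 1) ->
    (\int[nu]_y ((h y * g y) ^+ 2)%:E <= \int[nu]_y (g y ^+ 2)%:E)%E.
  move=> th h1; apply: ge0_integral_le => //.
  - by apply/measurable_EFinP; apply: measurable_funX; exact: tame_measurable th.
  - by apply/measurable_EFinP; exact: measurable_funX.
  - by move=> y; rewrite lee_fin exprMn ler_piMl ?sqr_ge0// -real_normK ?num_real// exprn_ile1.
have -> : (4 * C)%:E = (2%:E * C%:E + 2%:E * C%:E)%E :> \bar R.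
  by rewrite -!EFinM -EFinD; congr EFin; ring.
rewrite ge0_muleDl ?mule_ge0 ?lee_fin// -!muleA.
apply: leeD; rewrite lee_pmul2l// ?lte_fin//.
- apply: le_trans (B _ _ tc) _; rewrite lee_wpmul2l ?lee_fin//.
  by apply: le_g2 => // y; exact: cos_max.
- apply: le_trans (B _ _ ts) _; rewrite lee_wpmul2l ?lee_fin//.
  by apply: le_g2 => // y; exact: sin_max.
Qed.

End bessel_phase.

(** * The Bessel inequality for a sum of phases in separate variables *)

Section bessel_product.
Context d1 d2 d3 d4 (X1 : measurableType d1) (Y1 : measurableType d2)
  (X2 : measurableType d3) (Y2 : measurableType d4) (R : realType).
Variables (mu1 : {sigma_finite_measure set X1 -> \bar R}).
Variables (nu1 : {sigma_finite_measure set Y1 -> \bar R}).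
Variables (mu2 : {sigma_finite_measure set X2 -> \bar R}).
Variables (nu2 : {sigma_finite_measure set Y2 -> \bar R}).

Let mu12 : {measure set (X1 * X2)%type -> \bar R} := (mu1 \x mu2)%E.
Let nu12 : {measure set (Y1 * Y2)%type -> \bar R} := (nu1 \x nu2)%E.

Definition phase_sum (phi1 : X1 -> Y1 -> R) (phi2 : X2 -> Y2 -> R)
  (x : X1 * X2) (y : Y1 * Y2) : R := phi1 x.1 y.1 + phi2 x.2 y.2.

Definition tensor (b1 : Y1 -> R) (b2 : Y2 -> R) (y : Y1 * Y2) : R :=
  b1 y.1 * b2 y.2.

Lemma window_tensor b1 b2 : window nu1 b1 -> window nu2 b2 ->
  window nu12 (tensor b1 b2).
Proof.
move=> [mb1 ib1 b1_01] [mb2 ib2 b2_01]; split.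
- by apply: measurable_funM; [exact: measurableT_comp mb1 measurable_fst|
    exact: measurableT_comp mb2 measurable_snd].
- exact: integrable_tensor.
- move=> y; have /andP[? ?] := b1_01 y.1; have /andP[? ?] := b2_01 y.2.
  by rewrite mulr_ge0// mulr_ile1.
Qed.

Variables (phi1 : X1 -> Y1 -> R) (phi2 : X2 -> Y2 -> R).
Variables (b1 : Y1 -> R) (b2 : Y2 -> R) (C1 C2 : R).
Hypotheses (mphi1 : jointly_measurable phi1) (mphi2 : jointly_measurable phi2).
Hypotheses (wb1 : window nu1 b1) (wb2 : window nu2 b2).

Let partial_osc c (g : Y1 * Y2 -> R) x1 y2 : R :=
  osc nu1 phi1 (cst c) (fun y1 => g (y1, y2)) x1.

Let tame1 g y2 : tame (tensor b1 b2) g -> tame b1 (fun y1 => g (y1, y2)).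
Proof.
move=> [mg [L gL]]; split; first exact: measurableT_comp mg (measurable_pair2 y2).
exists (L * b2 y2) => y1; apply: le_trans (gL _) _.
by rewrite /tensor /= mulrAC mulrA.
Qed.

Let measurable_partial_osc c g : tame (tensor b1 b2) g ->
  jointly_measurable (partial_osc c g).
Proof.
move=> [mg _]; rewrite /jointly_measurable /partial_osc /osc.
apply: (@measurable_Rintegral _ _ _ _ _ nu1
  (fun z y1 => cos (phi1 z.1 y1 + cst c y1) * g (y1, z.2))).
apply: measurable_funM.
  apply: measurable_fun_cos; apply: measurable_funD => //.
  apply: (measurable_joint_comp mphi1) => //.
  by apply: measurableT_comp => //; exact: measurable_fst.
apply: (measurableT_comp mg); apply: measurable_fun_pair => //.
by apply: measurableT_comp => //; exact: measurable_snd.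
Qed.

(** Since [L * b1] is integrable, the transform in the first variable is still bounded by a multiple
    of [b2], so the inequality in the second variable applies to it. *)
Let tame_partial_osc c g x1 : tame (tensor b1 b2) g ->
  tame b2 (partial_osc c g x1).
Proof.
move=> tg; split; first exact: jointly_measurable1 (measurable_partial_osc c tg).
have [mg [L gL]] := tg; have [mb1 ib1 _] := wb1.
exists (\int[nu1]_y1 (L * b1 y1)) => y2; rewrite -RintegralZr//; last first.
  exact: (integrableZl measurableT L ib1).
apply: norm_Rintegral_le.
- apply: measurable_funM; last exact: tame_measurable (tame1 y2 tg).
  by apply: measurable_fun_cos; apply: measurable_funD => //;
    exact: jointly_measurable1.
- have iL : nu1.-integrable setT (EFin \o (fun y => L * b1 y)).
    exact: (integrableZl measurableT L ib1).
  exact: (integrableZr measurableT (b2 y2) iL).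
- move=> y1; rewrite -mulrA; apply: le_trans (gL (y1, y2)); rewrite normrM.
  by rewrite ler_piMl// cos_max.
Qed.

Let measurable_iterated_osc c c' g : tame (tensor b1 b2) g ->
  measurable_fun setT (fun z : X1 * X2 =>
    osc nu2 phi2 (cst c) (partial_osc c' g z.1) z.2).
Proof.
move=> tg; apply: (@measurable_Rintegral _ _ _ _ _ nu2
  (fun (z : X1 * X2) y2 => cos (phi2 z.2 y2 + cst c y2) * partial_osc c' g z.1 y2)).
apply: measurable_funM.
  apply: measurable_fun_cos; apply: measurable_funD => //.
  apply: (measurable_joint_comp mphi2) => //.
  by apply: measurableT_comp => //; exact: measurable_snd.
apply: (measurable_joint_comp (measurable_partial_osc c' tg)) => //.
by apply: measurableT_comp => //; exact: measurable_fst.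
Qed.

(** The addition formula for cos (phi1 + (phi2 + c)) separates the variables, and Fubini turns each
    term into an iterated transform. *)
Let osc_prod g c x1 x2 : tame (tensor b1 b2) g ->
  osc nu12 (phase_sum phi1 phi2) (cst c) g (x1, x2) =
  osc nu2 phi2 (cst c) (partial_osc 0 g x1) x2 -
  osc nu2 phi2 (cst (c - pi / 2)) (partial_osc (- (pi / 2)) g x1) x2.
Proof.
move=> tg; have [mg [L gL]] := tg; have [[mb1 ib1 _] [mb2 ib2 _]] := (wb1, wb2).
rewrite {1}/osc.
pose F (y1 : Y1) (y2 : Y2) : R :=
  cos (phase_sum phi1 phi2 (x1, x2) (y1, y2) + cst c (y1, y2)) * g (y1, y2).
transitivity (\int[(nu1 \x nu2)%E]_z F z.1 z.2).
  by apply: eq_Rintegral => -[].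
have mF : jointly_measurable F.
  apply: measurable_funM; last first.
    by rewrite (_ : (fun _ => _) = g)//; apply/funext => -[].
  apply: measurable_fun_cos; apply: measurable_funD => //.
  apply: measurable_funD.
    exact: measurableT_comp (jointly_measurable1 x1 mphi1) measurable_fst.
  exact: measurableT_comp (jointly_measurable1 x2 mphi2) measurable_snd.
rewrite (@rfubini_prod2 _ _ _ _ _ nu1 nu2 F (fun y => L * b1 y) b2)//; first last.
- move=> y1 y2; rewrite -mulrA; apply: le_trans (gL (y1, y2)); rewrite normrM.
  by rewrite ler_piMl// cos_max.
- exact: (integrableZl measurableT L ib1).
rewrite /osc -RintegralB//; first last.
- exact: (osc_integrable x2 wb2 (tame_partial_osc _ x1 tg)).
- exact: (osc_integrable x2 wb2 (tame_partial_osc _ x1 tg)).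
apply: eq_Rintegral => y2 _.
rewrite /partial_osc /osc -!RintegralZl//; first last.
- exact: (osc_integrable x1 wb1 (tame1 y2 tg)).
- exact: (osc_integrable x1 wb1 (tame1 y2 tg)).
rewrite -RintegralB//; first last.
- apply: integrable_Rscale.
  exact: (osc_integrable x1 wb1 (tame1 y2 tg)).
- apply: integrable_Rscale.
  exact: (osc_integrable x1 wb1 (tame1 y2 tg)).
apply: eq_Rintegral => y1 _; rewrite /F /phase_sum /=.
rewrite addr0 -addrA (cosD (phi1 x1 y1) (phi2 x2 y2 + c)) (addrA (phi2 x2 y2) c) !cosBpihalf.
by rewrite mulrBl !mulrA [cos (phi1 _ _) * _]mulrC [sin (phi1 _ _) * _]mulrC.
Qed.

(** For fixed x1 the inequality of the second factor bounds each of the two iterated transforms;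
    after an exchange of integrals, that of the first factor applies for fixed y2. Each term
    contributes 2 C1 C2. *)
Lemma bessel_prod : 0 <= C1 -> 0 <= C2 ->
  bessel mu1 nu1 phi1 b1 C1 -> bessel mu2 nu2 phi2 b2 C2 ->
  bessel mu12 nu12 (phase_sum phi1 phi2) (tensor b1 b2)
    (4 * C1 * C2).
Proof.
move=> C10 C20 B1 B2 g c tg; have [mg _] := tg.
have mphi : jointly_measurable (phase_sum phi1 phi2).
  apply: measurable_funD.
    apply: (measurable_joint_comp mphi1); apply: measurableT_comp => //;
      exact: measurable_fst.
  apply: (measurable_joint_comp mphi2); apply: measurableT_comp => //;
    exact: measurable_snd.
have sq0 (z : R) : (0 <= (z ^+ 2)%:E)%E by rewrite lee_fin sqr_ge0.
have mosc : measurable_fun setT (fun x =>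
    (osc nu12 (phase_sum phi1 phi2) (cst c) g x ^+ 2)%:E).
  apply/measurable_EFinP; apply: measurable_funX.
  rewrite (_ : osc _ _ _ _ = fun z =>
    osc nu2 phi2 (cst c) (partial_osc 0 g z.1) z.2 -
    osc nu2 phi2 (cst (c - pi / 2)) (partial_osc (- (pi / 2)) g z.1) z.2); last first.
    by apply/funext => -[x1 x2]; rewrite osc_prod.
  by apply: measurable_funB; exact: measurable_iterated_osc.
have mg2 : measurable_fun setT (fun z => (g z ^+ 2)%:E).
  by apply/measurable_EFinP; exact: measurable_funX.
have mpo2 c' : measurable_fun setT
    (fun z => (partial_osc c' g z.1 z.2 ^+ 2)%:E).
  apply/measurable_EFinP; apply: measurable_funX; exact: measurable_partial_osc.
rewrite fubini_tonelli1//.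
(* Squared norm of the partial transform in the mixed variables (x1, y2): exchanging the integrals
   puts x1 inside, where [B1] applies for each y2. *)
pose A c' := (\int[mu1]_x1 \int[nu2]_y2 (partial_osc c' g x1 y2 ^+ 2)%:E)%E.
have A_le c' : (A c' <= C1%:E * \int[(nu1 \x nu2)%E]_z (g z ^+ 2)%:E)%E.
  rewrite /A (@tonelli_swap _ _ _ _ _ mu1 nu2
    (fun x1 y2 => (partial_osc c' g x1 y2 ^+ 2)%:E))// fubini_tonelli2//.
  rewrite -ge0_integralZl_EFin//; last 2 first.
  - by move=> y _; exact: integral_ge0.
  - exact: measurable_fun_fubini_tonelli_G.
  apply: ge0_integral_le.
  - exact: (@ge0_measurable_integral2 _ _ _ _ _ mu1
      (fun x1 y2 => (partial_osc c' g x1 y2 ^+ 2)%:E))%E.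
  - apply: measurable_funeM.
    exact: measurable_fun_fubini_tonelli_G.
  - by move=> y2; exact: integral_ge0.
  - by move=> y2; apply: B1; exact: tame1.
have mA c' : measurable_fun setT
    (fun x1 => \int[nu2]_y2 (partial_osc c' g x1 y2 ^+ 2)%:E)%E.
  exact: (@ge0_measurable_integral _ _ _ _ _ nu2
    (fun x1 y2 => (partial_osc c' g x1 y2 ^+ 2)%:E))%E.
pose M := ((2 * C2)%:E * A 0%R + (2 * C2)%:E * A (- (pi / 2))%R)%E.
have AE c' : ((2 * C2)%:E * A c' =
    \int[mu1]_x1 ((2 * C2)%:E * \int[nu2]_y2 (partial_osc c' g x1 y2 ^+ 2)%:E))%E.
  by rewrite ge0_integralZl_EFin ?mulr_ge0// => x _; exact: integral_ge0.
have mCA c' : measurable_fun setT (fun x1 =>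
    ((2 * C2)%:E * \int[nu2]_y2 (partial_osc c' g x1 y2 ^+ 2)%:E)%E).
  by apply: measurable_funeM.
have CA0 c' x1 : (0 <= (2 * C2)%:E * \int[nu2]_y2 (partial_osc c' g x1 y2 ^+ 2)%:E)%E.
  by rewrite mule_ge0 ?lee_fin ?mulr_ge0// integral_ge0.
have ME : M = (\int[mu1]_x1 ((2 * C2)%:E * \int[nu2]_y2 (partial_osc 0 g x1 y2 ^+ 2)%:E +
    (2 * C2)%:E * \int[nu2]_y2 (partial_osc (- (pi / 2)) g x1 y2 ^+ 2)%:E))%E.
  rewrite ge0_integralD//.
  by rewrite /M; congr (_ + _)%E; exact: AE.
apply: (@le_trans _ _ M); last first; rewrite /M.
  apply: (le_trans (leeD (lee_wpmul2l _ (A_le _)) (lee_wpmul2l _ (A_le _)))).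
  - by rewrite lee_fin mulr_ge0.
  - by rewrite lee_fin mulr_ge0.
  rewrite !muleA -ge0_muleDl ?mule_ge0 ?lee_fin ?mulr_ge0//.
  by rewrite -!EFinM -EFinD (_ : _ + _ = 4 * C1 * C2)//; ring.
rewrite -/M ME.
apply: ge0_integral_le.
- exact: measurable_fun_fubini_tonelli_F.
- exact: emeasurable_funD.
- by move=> x1; exact: integral_ge0.
move=> x1; rewrite /fubini_F /=.
under eq_integral => x2 _ do rewrite osc_prod//.
apply: le_trans (integral_sqrB_le _ _ _) _.
- by apply: measurable_osc => //; exact: tame_measurable (tame_partial_osc _ x1 tg).
- by apply: measurable_osc => //; exact: tame_measurable (tame_partial_osc _ x1 tg).
rewrite !EFinM -!muleA; apply: leeD; rewrite lee_pmul2l// ?lte_fin//.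
- by apply: B2; exact: tame_partial_osc.
- by apply: B2; exact: tame_partial_osc.
Qed.

End bessel_product.

(** * Fatou's lemma and integrals over intervals *)

Section fatou_bounds.
Context d (T : measurableType d) (R : realType).
Variable mu : {measure set T -> \bar R}.
Local Open Scope ereal_scope.

Lemma limn_einf_le_cst (u : (\bar R)^nat) C : (forall k, u k <= C) ->
  limn_einf u <= C.
Proof.
move=> uC; rewrite limn_einf_lim; apply: lime_le.
  exact: is_cvg_einfs.
apply: nearW => n; apply: le_trans (uC n).
by apply: ereal_inf_lbound; exists n => /=.
Qed.

Lemma measurable_limn_einf (f : (T -> \bar R)^nat) :
  (forall n, measurable_fun setT (f n)) ->
  measurable_fun setT (fun x => limn_einf (f^~ x)).
Proof.
move=> mf; apply: (@emeasurable_fun_cvg _ _ _ _ (fun n x => einfs (f^~ x) n)) => //.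
  exact: measurable_fun_einfs.
by move=> x _; rewrite limn_einf_lim; exact: is_cvg_einfs.
Qed.

Lemma integral_limn_einf_le (f : (T -> \bar R)^nat) C :
  (forall n, measurable_fun setT (f n)) -> (forall n x, 0 <= f n x) ->
  (forall n, \int[mu]_x f n x <= C) ->
  \int[mu]_x limn_einf (f^~ x) <= C.
Proof.
move=> mf f0 fC; apply: le_trans (fatou mu measurableT mf _) _ => //.
exact: limn_einf_le_cst.
Qed.

End fatou_bounds.

Section integrals_on_intervals.
Context (R : realType).
Implicit Types (f F G : R -> R) (a b c k x z : R).
Local Notation leb := (@lebesgue_measure R).

Lemma Rintegral_FTC F f a b : a <= b -> (forall x, is_derive x 1 F (f x)) ->
  continuous f -> \int[leb]_(x in `[a, b]) f x = F b - F a.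
Proof.
rewrite le_eqVlt => /predU1P[->|ab] dF cf.
  by rewrite set_itv1 Rintegral_set1 subrr.
have cF : continuous F.
  by move=> x; apply: differentiable_continuous; apply/derivable1_diffP; case: (dF x).
rewrite /Rintegral (@continuous_FTC2 _ f F)//.
- exact: continuous_subspaceT.
- split=> [x _||]; first by case: (dF x).
  + by apply: cvg_at_right_filter; exact: cF.
  + by apply: cvg_at_left_filter; exact: cF.
- by move=> x _; rewrite derive1E; case: (dF x).
Qed.

Definition box1 k x : R := \1_`[- k, k] x.

Lemma box1E k x : box1 k x = ((- k <= x <= k)%R)%:R :> R.
Proof. by rewrite /box1 indicE mem_setE in_itv. Qed.

Lemma box1_01 k x : 0 <= box1 k x <= 1.
Proof. by rewrite box1E; case: (- k <= x <= k); rewrite ?lexx ?ler01. Qed.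

Lemma measurable_box1 k : measurable_fun setT (box1 k).
Proof. exact: measurable_indic. Qed.

Lemma measurable_itv_indic (i : interval R) :
  measurable_fun setT (\1_([set` i]) : R -> R).
Proof. by apply: measurable_indic. Qed.

Lemma Rintegral_indicl (D : set R) f :
  \int[leb]_(x in D) f x = \int[leb]_x (\1_D x * f x).
Proof.
rewrite Rintegral_mkcond; apply: eq_Rintegral => x _.
by rewrite patchE indicE; case: ifPn => _; rewrite ?mul1r ?mul0r.
Qed.

Lemma integrable_itv_indic a b :
  leb.-integrable setT (EFin \o (\1_`[a, b] : R -> R)).
Proof.
exact: integrable_indic_itv.
Qed.

Lemma integral_itv_indic a b : a <= b -> \int[leb]_x \1_`[a, b] x = b - a.
Proof.
move=> ab; rewrite /Rintegral integral_indic//= setIT lebesgue_measure_itv/= lte_fin.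
by move: ab; rewrite le_eqVlt => /predU1P[->|->]//; rewrite ltxx subrr.
Qed.

Lemma window_box1 k : window leb (box1 k).
Proof.
split; [exact: measurable_box1|exact: integrable_itv_indic|exact: box1_01].
Qed.

End integrals_on_intervals.

(** * The Bessel inequality on the line *)

Section bessel_line.
Context (R : realType).
Implicit Types (g : R -> R) (c k z : R).
Local Notation leb := (@lebesgue_measure R).

(** A sharp cutoff has a transform of size 1/|z|, which is not integrable at infinity. This weight
    vanishes at k and -k, so its transform decays like 1/(k z^2), and it tends to 1 pointwise as k
    grows. *)
Definition bump k x : R := box1 k x * (1 - x ^+ 2 / k ^+ 2).

Lemma bump_01 k x : 0 < k -> 0 <= bump k x <= 1.
Proof.
move=> k0; rewrite /bump box1E; case: (boolP (- k <= x <= k)) => [/andP[kx xk]|_]; last first.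
  by rewrite mul0r lexx ler01.
have : x ^+ 2 / k ^+ 2 <= 1 by rewrite ler_pdivrMr ?exprn_gt0// mul1r; nra.
have : 0 <= x ^+ 2 / k ^+ 2 by rewrite divr_ge0// sqr_ge0.
by rewrite mul1r => ? ?; apply/andP; split; lra.
Qed.

Lemma bump_le_box1 k x : 0 < k -> bump k x <= box1 k x.
Proof.
move=> k0; have := bump_01 x k0; rewrite /bump box1E; case: (boolP (- k <= x <= k)) => _.
  by rewrite mul1r => /andP[].
by rewrite mul0r.
Qed.

Lemma measurable_bump k : measurable_fun setT (bump k).
Proof.
apply: measurable_funM; first exact: measurable_box1.
by apply: measurable_funB => //; apply: measurable_funM => //; exact: measurable_funX.
Qed.

Definition bump_hat k z c : R := \int[leb]_x (bump k x * cos (x * z + c)).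

Lemma bump_hat_integrable k z c : 0 < k ->
  leb.-integrable setT (EFin \o (fun x => bump k x * cos (x * z + c))).
Proof.
move=> k0; apply: (@dom_integrable _ _ _ leb _ (box1 k)).
- apply: measurable_funM; first exact: measurable_bump.
  by apply: measurable_fun_cos; apply: measurable_funD => //; exact: measurable_funM.
- exact: integrable_itv_indic.
- move=> x; have /andP[w0 w1] := bump_01 x k0.
  rewrite normrM (ger0_norm w0); apply: le_trans (bump_le_box1 x k0).
  by rewrite ler_piMr// cos_max.
Qed.

Lemma bump_hat_small k z c : 0 < k -> `|bump_hat k z c| <= 2 * k.
Proof.
move=> k0; have kk : - k <= k by lra.
apply: le_trans (@norm_Rintegral_le _ _ _ leb _ (box1 k) _ _ _) _.
- apply: measurable_funM; first exact: measurable_bump.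
  by apply: measurable_fun_cos; apply: measurable_funD => //; exact: measurable_funM.
- exact: integrable_itv_indic.
- move=> x; have /andP[w0 w1] := bump_01 x k0.
  rewrite normrM (ger0_norm w0); apply: le_trans (bump_le_box1 x k0).
  by rewrite ler_piMr// cos_max.
- by rewrite /box1 integral_itv_indic//; lra.
Qed.

Lemma cos_affine_continuous z c : continuous (fun x : R => cos (x * z + c)).
Proof.
move=> x.
have h : {for x, continuous (fun y : R => y * z + c)}.
  by apply: cvgD; [apply: cvgM; [exact: cvg_id|exact: cvg_cst]|exact: cvg_cst].
exact: (continuous_comp h (@continuous_cos R _)).
Qed.

(* The primitive z (1 - x^2/k^2) sin(xz + c) - (2x/k^2) cos(xz + c) comes from
   one integration by parts; it avoids dividing by z. *)
Lemma bump_hat_decay k z c : 0 < k -> `|z ^+ 2 * bump_hat k z c| <= 8 / k.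
Proof.
move=> k0; have kk : - k <= k by lra.
have kn0 : k != 0 by rewrite gt_eqF.
pose G x := z * (1 - x ^+ 2 / k ^+ 2) * sin (x * z + c) -
  2 * x / k ^+ 2 * cos (x * z + c).
pose f x := z ^+ 2 * ((1 - x ^+ 2 / k ^+ 2) * cos (x * z + c)) -
  2 / k ^+ 2 * cos (x * z + c).
have dG (x : R) : is_derive x 1 G (f x).
  apply: is_derive_eq.
  by rewrite /f /GRing.scale /=; field.
have cf : continuous f.
  move=> x; apply: cvgB; last first.
    by apply: cvgM; [exact: cvg_cst|exact: cos_affine_continuous].
  apply: cvgM; first exact: cvg_cst.
  apply: cvgM; last exact: cos_affine_continuous.
  apply: cvgB; first exact: cvg_cst.
  by apply: cvgM; [exact: exprn_continuous|exact: cvg_cst].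
have := Rintegral_FTC kk dG cf; rewrite Rintegral_indicl -/(box1 k).
have ic : leb.-integrable setT (EFin \o (fun x => box1 k x * cos (x * z + c))).
  apply: (@dom_integrable _ _ _ leb _ (box1 k)).
  - apply: measurable_funM; first exact: measurable_box1.
    by apply: measurable_fun_cos; apply: measurable_funD => //; exact: measurable_funM.
  - exact: integrable_itv_indic.
  - move=> x; have /andP[w0 w1] := box1_01 k x.
    by rewrite normrM (ger0_norm w0) ler_piMr// cos_max.
have -> : \int[leb]_x (\1_`[- k, k] x * f x) = z ^+ 2 * bump_hat k z c -
    2 / k ^+ 2 * \int[leb]_x (box1 k x * cos (x * z + c)).
  rewrite -!RintegralZl//; last exact: bump_hat_integrable.
  rewrite -RintegralB//; first last.
  - exact: integrable_Rscale.
  - by apply: integrable_Rscale; exact: bump_hat_integrable.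
  apply: eq_Rintegral => x _; rewrite /f /bump /box1; ring.
have cb : `|\int[leb]_x (box1 k x * cos (x * z + c))| <= 2 * k.
  apply: le_trans (@norm_Rintegral_le _ _ _ leb _ (box1 k) _ _ _) _.
  - apply: measurable_funM; first exact: measurable_box1.
    by apply: measurable_fun_cos; apply: measurable_funD => //; exact: measurable_funM.
  - exact: integrable_itv_indic.
  - move=> x; have /andP[w0 w1] := box1_01 k x.
    by rewrite normrM (ger0_norm w0) ler_piMr// cos_max.
  - by rewrite /box1 integral_itv_indic//; lra.
move: cb; set J := \int[leb]_x _; set B := z ^+ 2 * _ => cb BE.
(* The sine part of [G] vanishes at both endpoints because the weight does; only the cosine terms
   survive, each of size at most 2/k. *)
have -> : B = 2 / k ^+ 2 * J - 2 / k * (cos (k * z + c) + cos (- k * z + c)).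
  have -> : B = 2 / k ^+ 2 * J + (G k - G (- k)) by rewrite -BE; ring.
  by rewrite /G; field.
have /ler_normlP[? ?] := cos_max (k * z + c).
have /ler_normlP[? ?] := cos_max (- k * z + c).
apply: le_trans (ler_normB _ _) _.
have -> : 8 / k = 2 / k ^+ 2 * (2 * k) + 2 / k * 2 by field.
apply: lerD; rewrite normrM ger0_norm ?divr_ge0 ?exprn_ge0 ?(ltW k0)//.
- by rewrite ler_wpM2l// divr_ge0 ?exprn_ge0 ?(ltW k0).
- rewrite ler_wpM2l ?divr_ge0 ?(ltW k0)//.
  by rewrite ler_norml; apply/andP; split; lra.
Qed.

(** This is 10 pi times the Poisson kernel of the half-plane at height 1/k, so its total mass 10 pi
    does not depend on k. The 10 is 2 + 8: the transform is at most 2 k, and k^2 z^2 times it at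
    most k^2 (8 / k). *)
Definition poisson k z : R := 10 * k / (1 + (k * z) ^+ 2).

Lemma bump_hat_le k z c : 0 < k -> `|bump_hat k z c| <= poisson k z.
Proof.
move=> k0; rewrite /poisson ler_pdivlMr; last by rewrite ltr_pwDl// sqr_ge0.
have := bump_hat_small z c k0; have := bump_hat_decay z c k0.
rewrite normrM ger0_norm ?sqr_ge0//.
set W := `|_| => h1 h2.
have : k ^+ 2 * (z ^+ 2 * W) <= k ^+ 2 * (8 / k) by rewrite ler_wpM2l// sqr_ge0.
have -> : k ^+ 2 * (8 / k) = 8 * k by field; rewrite gt_eqF.
by rewrite exprMn mulrDr mulr1; nra.
Qed.

Lemma poisson_ge0 k z : 0 < k -> 0 <= poisson k z.
Proof.
by move=> k0; rewrite divr_ge0 ?mulr_ge0 ?(ltW k0)// addr_ge0// sqr_ge0.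
Qed.

Lemma poisson_le k z : 0 < k -> poisson k z <= 10 * k.
Proof.
move=> k0; rewrite /poisson ler_pdivrMr; last by rewrite ltr_pwDl// sqr_ge0.
by rewrite ler_peMr ?mulr_ge0 ?(ltW k0)// lerDl sqr_ge0.
Qed.

Lemma poissonN k z : poisson k (- z) = poisson k z.
Proof. by rewrite /poisson mulrN sqrrN. Qed.

Lemma measurable_poisson k d (T : measurableType d) (f : T -> R) : 0 < k ->
  measurable_fun setT f -> measurable_fun setT (fun t => poisson k (f t)).
Proof.
move=> k0; apply: measurableT_comp; apply: continuous_measurable_fun => z.
apply: cvgM; first exact: cvg_cst.
apply: cvgV; first by rewrite gt_eqF// ltr_pwDl// sqr_ge0.
apply: cvgD; first exact: cvg_cst.
have h : {for z, continuous (fun z : R => k * z)} by exact: mulrl_continuous.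
exact: (continuous_comp h (@exprn_continuous R 2 _)).
Qed.

(** The primitive 10 atan varies by less than 10 pi whatever k, N and the centre y: this is the row
    bound of the Schur test. *)
Lemma integral_poisson_le k N y : 0 < k -> 0 < N ->
  \int[leb]_x (box1 N x * poisson k (x - y)) <= 10 * pi.
Proof.
move=> k0 N0; have NN : - N <= N by lra.
have dP (x : R) : is_derive x 1 (fun x => 10 * atan (k * (x - y))) (poisson k (x - y)).
  apply: is_derive_eq.
  rewrite /GRing.scale /= /poisson; field.
  by rewrite gt_eqF// ltr_pwDl// sqr_ge0.
rewrite -Rintegral_indicl (Rintegral_FTC NN dP).
  have := atan_ltpi2 (k * (N - y)); have := atan_gtNpi2 (k * (- N - y)).
  by lra.
move=> z; apply: cvgM; first exact: cvg_cst.
apply: cvgV; first by rewrite gt_eqF// ltr_pwDl// sqr_ge0.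
apply: cvgD; first exact: cvg_cst.
have h : {for z, continuous (fun z : R => k * (z - y))}.
  by apply: cvgM; [exact: cvg_cst|apply: cvgB; [exact: cvg_id|exact: cvg_cst]].
exact: (continuous_comp h (@exprn_continuous R 2 _)).
Qed.

End bessel_line.

Section bessel_line_theorem.
Context (R : realType).
Implicit Types (g : R -> R) (c k L N : R).
Local Notation leb := (@lebesgue_measure R).

Definition line_phase (x y : R) : R := x * y.

Lemma measurable_line_phase : jointly_measurable line_phase.
Proof. exact: measurable_funM. Qed.

Definition bump_kernel k c y z : R :=
  \int[leb]_x (bump k x * cos (x * y + c) * cos (x * z + c)).

(** Product-to-sum formula. Besides the difference of the frequencies, which complex exponentials
    would give alone, real cosines produce their sum, with phase 2 c; hence the two terms of
    [poisson_sum]. *)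
Lemma bump_kernelE k c y z : 0 < k -> bump_kernel k c y z =
  2^-1 * bump_hat k (y - z) 0 + 2^-1 * bump_hat k (y + z) (c + c).
Proof.
move=> k0; rewrite /bump_kernel /bump_hat -!RintegralZl//; last 2 first.
- exact: bump_hat_integrable.
- exact: bump_hat_integrable.
rewrite -RintegralD//; last 2 first.
- by apply: integrable_Rscale; exact: bump_hat_integrable.
- by apply: integrable_Rscale; exact: bump_hat_integrable.
apply: eq_Rintegral => x _.
rewrite (_ : x * (y - z) + 0 = (x * y + c) - (x * z + c)); last by ring.
rewrite (_ : x * (y + z) + (c + c) = (x * y + c) + (x * z + c)); last by ring.
by rewrite (cosB (x * y + c)) (cosD (x * y + c) (x * z + c)); field.
Qed.

Definition poisson_sum k y z : R := poisson k (y - z) + poisson k (y + z).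

Lemma poisson_sum_ge0 k y z : 0 < k -> 0 <= poisson_sum k y z.
Proof. by move=> k0; rewrite addr_ge0// poisson_ge0. Qed.

Lemma poisson_sum_le k y z : 0 < k -> poisson_sum k y z <= 20 * k.
Proof.
move=> k0; have := poisson_le (y - z) k0; have := poisson_le (y + z) k0.
by rewrite /poisson_sum; lra.
Qed.

Lemma poisson_sumC k y z : poisson_sum k y z = poisson_sum k z y.
Proof. by rewrite /poisson_sum -poissonN opprB addrC [z + y]addrC addrC. Qed.

Lemma measurable_poisson_sum k : 0 < k -> jointly_measurable (poisson_sum k).
Proof.
move=> k0; apply: measurable_funD; apply: measurable_poisson => //.
- exact: measurable_funB.
- exact: measurable_funD.
Qed.

Lemma bump_kernel_le k c y z : 0 < k ->
  `|bump_kernel k c y z| <= 2^-1 * poisson_sum k y z.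
Proof.
move=> k0; rewrite bump_kernelE// (le_trans (ler_normD _ _))//.
rewrite !normrM (ger0_norm (_ : 0 <= 2^-1))// /poisson_sum mulrDr.
by apply: lerD; rewrite ler_wpM2l// bump_hat_le.
Qed.

Lemma measurable_cos_line c d (T : measurableType d) (f h : T -> R) :
  measurable_fun setT f -> measurable_fun setT h ->
  measurable_fun setT (fun t => cos (f t * h t + c)).
Proof.
move=> mf mh; apply: measurable_fun_cos; apply: measurable_funD => //.
exact: measurable_funM.
Qed.

Lemma measurable_bump_kernel k c : jointly_measurable (bump_kernel k c).
Proof.
apply: (@measurable_Rintegral _ _ _ _ _ leb (fun (w : R * R) (x : R) =>
  bump k x * cos (x * w.1 + c) * cos (x * w.2 + c))).
apply: measurable_funM; last first.
  apply: measurable_cos_line => //.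
  by apply: measurableT_comp => //; exact: measurable_fst.
apply: measurable_funM.
  by apply: measurableT_comp => //; exact: measurable_bump.
apply: measurable_cos_line => //.
by apply: measurableT_comp => //; exact: measurable_fst.
Qed.

Section quadratic_form.
Variables (g : R -> R) (c k L N : R).
Hypotheses (mg : measurable_fun setT g) (gL : forall y, `|g y| <= L * box1 N y).
Hypotheses (k0 : 0 < k) (N0 : 0 < N).

Let F := osc leb line_phase (cst c) g.

Let tg : tame (box1 N) g. Proof. by split => //; exists L. Qed.

Let iL : leb.-integrable setT (EFin \o (fun y => L * box1 N y)).
Proof. by apply: integrable_Rscale; exact: integrable_itv_indic. Qed.

Let cos_g_le x y : `|cos (x * y + c) * g y| <= L * box1 N y.
Proof. by rewrite normrM; apply: le_trans (gL y); rewrite ler_piMl// cos_max. Qed.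

Let F_le x : `|F x| <= \int[leb]_y (L * box1 N y).
Proof.
apply: (@norm_Rintegral_le _ _ _ leb) => //.
by apply: measurable_funM => //; exact: measurable_cos_line.
Qed.

Let mF : measurable_fun setT F.
Proof. by apply: measurable_osc => //; exact: measurable_line_phase. Qed.

Let bump0 x : 0 <= bump k x. Proof. by have /andP[] := bump_01 x k0. Qed.

Let norm_bump_le x : `|bump k x| <= box1 k x.
Proof. by rewrite ger0_norm// bump_le_box1. Qed.

(** [F x ^+ 2] is opened one factor at a time. The weight has bounded support, so each time the
    integrand has a tensor majorant and Fubini applies. *)
Lemma bump_quadratic_form : \int[leb]_x (bump k x * F x ^+ 2) =
  \int[leb]_y \int[leb]_z (g y * g z * bump_kernel k c y z).
Proof.
pose M := \int[leb]_y (L * box1 N y).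
have ig x : leb.-integrable setT (EFin \o (fun y => cos (x * y + c) * g y)).
  apply: (@dom_integrable _ _ _ leb _ (fun y => L * box1 N y)) => //.
  by apply: measurable_funM => //; exact: measurable_cos_line.
transitivity (\int[leb]_x \int[leb]_y (bump k x * F x * (cos (x * y + c) * g y))).
  apply: eq_Rintegral => x _.
  by rewrite RintegralZl// expr2 mulrA.
rewrite (@rfubini _ _ _ _ _ leb leb _ (fun x => M * box1 k x)
  (fun y => L * box1 N y))//; first last.
- move=> x y; rewrite normrM ler_pM// normrM mulrC ler_pM//.
- by apply: integrable_Rscale; exact: integrable_itv_indic.
- apply: measurable_funM.
    apply: measurable_funM.
      by apply: measurableT_comp => //; exact: measurable_bump.
    exact: measurableT_comp mF measurable_fst.
  apply: measurable_funM; first exact: measurable_cos_line.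
  exact: measurableT_comp mg measurable_snd.
apply: eq_Rintegral => y _.
transitivity (\int[leb]_x \int[leb]_z
    (bump k x * (cos (x * y + c) * g y) * (cos (x * z + c) * g z))).
  apply: eq_Rintegral => x _.
  by rewrite RintegralZl// /F /osc /line_phase /=; ring.
rewrite (@rfubini _ _ _ _ _ leb leb _ (fun x => L * box1 N y * box1 k x)
    (fun y => L * box1 N y))//; first last.
- move=> x z; rewrite normrM ler_pM// normrM mulrC ler_pM//.
- by apply: integrable_Rscale; exact: integrable_itv_indic.
- apply: measurable_funM.
    apply: measurable_funM.
      by apply: measurableT_comp => //; exact: measurable_bump.
    by apply: measurable_funM => //; exact: measurable_cos_line.
  apply: measurable_funM; first exact: measurable_cos_line.
  exact: measurableT_comp mg measurable_snd.
apply: eq_Rintegral => z _.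
rewrite /bump_kernel -RintegralZl//; last first.
  apply: (@dom_integrable _ _ _ leb _ (box1 k)).
  - apply: measurable_funM; last exact: measurable_cos_line.
    by apply: measurable_funM; [exact: measurable_bump|exact: measurable_cos_line].
  - exact: integrable_itv_indic.
  - move=> x; apply: le_trans (norm_bump_le x).
    by rewrite !normrM -mulrA ler_piMr// mulr_ile1// cos_max.
apply: eq_Rintegral => x _; ring.
Qed.

(** Integrand of the Schur test. The factor [box1 N z] costs nothing, as [g] vanishes outside the
    box, and it gives [J] a tensor majorant. *)
Let J y z := box1 N z * g y ^+ 2 * poisson_sum k y z.

Let L0 : 0 <= L.
Proof.
have := gL 0; rewrite box1E (_ : - N <= 0 <= N) ?mulr1; last first.
  by rewrite oppr_le0 !ltW.
exact: le_trans.
Qed.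

Let sq_g_le y : g y ^+ 2 <= L ^+ 2 * box1 N y.
Proof.
have := gL y; rewrite box1E; case: (- N <= y <= N); rewrite /= ?mulr1 ?mulr0.
  move=> h; have := ler_pM (normr_ge0 _) (normr_ge0 _) h h.
  by rewrite -!expr2 real_normK ?num_real.
by rewrite normr_le0 => /eqP ->; rewrite expr0n.
Qed.

Let J_le y z : `|J y z| <= L ^+ 2 * box1 N y * (20 * k * box1 N z).
Proof.
have /andP[b0 b1] := box1_01 N z.
have S0 := poisson_sum_ge0 y z k0; have g0 := sqr_ge0 (g y).
rewrite ger0_norm; last exact: (mulr_ge0 (mulr_ge0 b0 g0) S0).
rewrite /J mulrAC mulrC; apply: ler_pM => //.
- exact: mulr_ge0.
- by rewrite mulrC ler_wpM2r// poisson_sum_le.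
Qed.

Let mJ : jointly_measurable J.
Proof.
apply: measurable_funM; last exact: measurable_poisson_sum.
apply: measurable_funM.
  by apply: measurableT_comp; [exact: measurable_box1|exact: measurable_snd].
by apply: measurable_funX; apply: measurableT_comp => //; exact: measurable_fst.
Qed.

Let mJ' : jointly_measurable (fun y z => J z y).
Proof.
rewrite /jointly_measurable /J /=.
apply: measurable_funM; last first.
  under eq_fun do rewrite poisson_sumC.
  exact: measurable_poisson_sum.
apply: measurable_funM.
  by apply: measurableT_comp; [exact: measurable_box1|exact: measurable_fst].
by apply: measurable_funX; apply: measurableT_comp => //; exact: measurable_snd.
Qed.

Let ip : leb.-integrable setT (EFin \o (fun y => L ^+ 2 * box1 N y)).
Proof. by apply: integrable_Rscale; exact: integrable_itv_indic. Qed.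

Let iq : leb.-integrable setT (EFin \o (fun y => 20 * k * box1 N y)).
Proof. by apply: integrable_Rscale; exact: integrable_itv_indic. Qed.

Let ig2 : leb.-integrable setT (EFin \o (fun y => g y ^+ 2)).
Proof.
apply: dom_integrable ip _; first exact: measurable_funX.
by move=> y; rewrite ger0_norm ?sqr_ge0//; exact: sq_g_le.
Qed.

(** For fixed y there are two Poisson kernels in z, centred at y and at -y, each of mass at most 10
    pi. *)
Let int_J : \int[leb]_y \int[leb]_z J y z <= 20 * pi * \int[leb]_y (g y ^+ 2).
Proof.
have iP y : leb.-integrable setT (EFin \o (fun z => box1 N z * poisson k (z - y))).
  apply: dom_integrable iq _.
    apply: measurable_funM; first exact: measurable_box1.
    by apply: measurable_poisson => //; exact: measurable_funB.
  move=> z; have /andP[b0 b1] := box1_01 N z.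
  have P0 := poisson_ge0 (z - y) k0; have P1 := poisson_le (z - y) k0.
  rewrite ger0_norm; last exact: mulr_ge0.
  by rewrite mulrC ler_wpM2r//; lra.
have JE y : \int[leb]_z J y z = g y ^+ 2 *
    (\int[leb]_z (box1 N z * poisson k (z - y)) +
     \int[leb]_z (box1 N z * poisson k (z - - y))).
  rewrite -RintegralD// -RintegralZl//; last first.
    have := integrableD measurableT (iP y) (iP (- y)); apply: eq_integrable => //.
  apply: eq_Rintegral => z _; rewrite /J /poisson_sum opprK -(poissonN k (y - z)).
  by rewrite opprB [y + z]addrC; ring.
rewrite -RintegralZl//; apply: le_trans (ler_norm _) _.
apply: norm_Rintegral_le; first exact: measurable_Rintegral.
  exact: integrable_Rscale.
move=> y; rewrite JE normrM (ger0_norm (sqr_ge0 _)) mulrC ler_wpM2r ?sqr_ge0//.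
rewrite ger0_norm; last first.
  by rewrite addr_ge0// Rintegral_ge0// => z _;
    rewrite mulr_ge0 ?poisson_ge0//; have /andP[] := box1_01 N z.
have := integral_poisson_le y k0 N0; have := integral_poisson_le (- y) k0 N0.
by lra.
Qed.

(** Schur test through |g y g z| <= (g y ^2 + g z ^2) / 2; the kernel bound brings the second factor
    1/2, and the boxes come from the support of [g]. *)
Let kernel_dominated y z : `|g y * g z * bump_kernel k c y z| <=
  4^-1 * (J y z + J z y).
Proof.
have K := bump_kernel_le c y z k0; have S0 := poisson_sum_ge0 y z k0.
have gg : `|g y * g z| <= 2^-1 * (box1 N z * g y ^+ 2 + box1 N y * g z ^+ 2).
  have sq (t : R) : `|t| ^+ 2 = t ^+ 2 by rewrite real_normK// num_real.
  have := gL y; have := gL z; rewrite !box1E normrM.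
  case: (- N <= y <= N); case: (- N <= z <= N); rewrite /= ?mulr1 ?mulr0 ?mul1r ?mul0r.
  - by move=> _ _; have := sqr_ge0 (`|g y| - `|g z|); rewrite sqrrB !sq mulr2n; lra.
  - rewrite normr_le0 => /eqP -> _; rewrite normr0 mulr0 expr0n addr0 mulr0//.
  - move=> _; rewrite normr_le0 => /eqP ->; rewrite normr0 mul0r expr0n addr0 mulr0//.
  - by rewrite normr_le0 => /eqP -> _; rewrite normr0 mulr0 addr0 mulr0.
rewrite normrM; apply: le_trans (ler_pM _ _ gg K) _ => //.
rewrite /J (poisson_sumC k z y); lra.
Qed.

(** [J y z] and [J z y] have the same integral, by Fubini in one order for each; it is at most 20 pi
    times the integral of g^2, and 4^-1 (20 pi + 20 pi) = 10 pi. *)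
Lemma bump_quadratic_form_le : \int[leb]_x (bump k x * F x ^+ 2) <=
  10 * pi * \int[leb]_y (g y ^+ 2).
Proof.
rewrite bump_quadratic_form.
pose T y z := g y * g z * bump_kernel k c y z.
have mT : jointly_measurable T.
  apply: measurable_funM; last exact: measurable_bump_kernel.
  by apply: measurable_funM; apply: measurableT_comp.
have T_le y z : `|T y z| <= L ^+ 2 * box1 N y * (20 * k * box1 N z).
  apply: le_trans (kernel_dominated y z) _.
  have := le_trans (ler_norm _) (J_le y z); have := le_trans (ler_norm _) (J_le z y).
  have /andP[? ?] := box1_01 N z; have /andP[? ?] := box1_01 N y.
  have : 0 <= L ^+ 2 * box1 N y * (20 * k * box1 N z).
    by rewrite !mulr_ge0 ?sqr_ge0// ltW.
  lra.
have J'_le y z : `|J z y| <= L ^+ 2 * box1 N y * (20 * k * box1 N z).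
  by apply: le_trans (J_le z y) _; rewrite le_eqVlt; apply/orP; left; apply/eqP; ring.
rewrite -(@rfubini_prod1 _ _ _ _ _ leb leb T _ _ mT ip iq T_le).
have iJ := (@rfubini_integrable _ _ _ _ _ leb leb J _ _ mJ ip iq J_le).
have iJ' := (@rfubini_integrable _ _ _ _ _ leb leb (fun y z => J z y) _ _ mJ' ip iq J'_le).
apply: (@le_trans _ _ (\int[(leb \x leb)%E]_w (4^-1 * (J w.1 w.2 + J w.2 w.1)))).
  apply: le_Rintegral => //.
  - exact: (@rfubini_integrable _ _ _ _ _ leb leb T _ _ mT ip iq T_le).
  - apply: integrable_Rscale; exact: (integrableD measurableT iJ iJ').
  - by move=> w _; apply: le_trans (ler_norm _) _; exact: kernel_dominated.
rewrite RintegralZl//; last exact: (integrableD measurableT iJ iJ').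
rewrite RintegralD// (@rfubini_prod1 _ _ _ _ _ leb leb J _ _ mJ ip iq J_le)
  (@rfubini_prod2 _ _ _ _ _ leb leb (fun y z => J z y) _ _ mJ' ip iq J'_le).
by have := int_J; lra.
Qed.

End quadratic_form.

Lemma bump_cvg x : bump n.+1%:R x @[n --> \oo] --> (1 : R).
Proof.
have h : (fun n => 1 - (x * harmonic n) ^+ 2) @ \oo --> (1 : R).
  rewrite -[X in _ --> X](_ : 1 - (x * 0) ^+ 2 = 1); last first.
    by rewrite mulr0 expr0n subr0.
  apply: cvgB; first exact: cvg_cst.
  rewrite expr2; under eq_cvg do rewrite expr2.
  by apply: cvgM; apply: cvgM; [exact: cvg_cst|exact: cvg_harmonic|
    exact: cvg_cst|exact: cvg_harmonic].
apply: cvg_trans h; apply: near_eq_cvg; near=> n.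
have nx : `|x| <= n.+1%:R.
  by apply: (@le_trans _ _ n%:R); [near: n; exact: nbhs_infty_ger|rewrite ler_nat].
rewrite /bump box1E -ler_norml nx mul1r /harmonic /=.
by rewrite exprMn exprVn.
Unshelve. all: by end_near. Qed.

(** The bound for the weighted form is independent of k, so Fatou's lemma removes the weight as k
    grows. The constant is also independent of N. *)
Lemma bessel_line N : 0 < N -> bessel leb leb line_phase (box1 N) (10 * pi).
Proof.
move=> N0 g c tg; have [mg [L gL]] := tg.
have mF : measurable_fun setT (osc leb line_phase (cst c) g).
  by apply: measurable_osc => //; exact: measurable_line_phase.
have wb := window_box1 N.
have L0 : 0 <= L.
  have := gL 0; rewrite box1E (_ : - N <= 0 <= N) ?mulr1; last first.
    by rewrite oppr_le0 !ltW.
  exact: le_trans.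
set F := osc _ _ _ _ in mF *.
have F_le x : `|F x| <= \int[leb]_y (L * box1 N y).
  apply: (@norm_Rintegral_le _ _ _ leb) => //.
  - by apply: measurable_funM => //; exact: measurable_cos_line.
  - by apply: integrable_Rscale; exact: integrable_itv_indic.
  - by move=> y; rewrite normrM; apply: le_trans (gL y); rewrite ler_piMl// cos_max.
have ig2 : leb.-integrable setT (EFin \o (fun y => g y ^+ 2)).
  under eq_fun do rewrite expr2.
  have [_ [L' gL']] := tg.
  apply: (tame_integrable wb); apply: (@tameM _ _ _ leb _ _ _ L) => //.
  move=> y; apply: le_trans (gL y) _; have /andP[? ?] := box1_01 N y.
  by rewrite ler_piMr.
have -> : ((10 * pi)%:E * \int[leb]_y (g y ^+ 2)%:E =
    (10 * pi * \int[leb]_y (g y ^+ 2))%:E)%E by rewrite -EFin_Rintegral// -EFinM.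
pose f n x := (bump n.+1%:R x * F x ^+ 2)%:E.
have fE x : (F x ^+ 2)%:E = limn_einf (f^~ x).
  apply/esym; apply: (cvg_limn_einf_sup _).1; apply: cvg_EFin; first exact: nearW.
  rewrite -[X in _ --> X]mul1r; apply: cvgM; [exact: bump_cvg|exact: cvg_cst].
under eq_integral => x _ do rewrite fE.
apply: integral_limn_einf_le.
- move=> n; apply/measurable_EFinP; apply: measurable_funM.
    exact: measurable_bump.
  exact: measurable_funX.
- move=> n x; rewrite lee_fin mulr_ge0 ?sqr_ge0//.
  by have /andP[] := @bump_01 _ n.+1%:R x (ltr0Sn _ _).
- move=> n; rewrite -EFin_Rintegral.
    by rewrite lee_fin; exact: (bump_quadratic_form_le c mg gL).
  pose M := \int[leb]_y (L * box1 N y).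
  apply: (@dom_integrable _ _ _ leb _ (fun x => M ^+ 2 * box1 n.+1%:R x)).
  - by apply: measurable_funM; [exact: measurable_bump|exact: measurable_funX].
  - by apply: integrable_Rscale; exact: integrable_itv_indic.
  - move=> x; have /andP[? ?] := @bump_01 _ n.+1%:R x (ltr0Sn _ _).
    rewrite normrM mulrC ler_pM//.
      rewrite normrX ler_pXn2r// nnegrE// (le_trans _ (F_le x))//.
    by rewrite ger0_norm// bump_le_box1.
Qed.

End bessel_line_theorem.

(** * Borel sets and continuous functions on R^n *)

Section borel_sets_rV.
Context (R : realType) (n : nat).

Lemma measurable_rV_cube (q : 'rV[R]_n) (r : R) :
  measurable [set x : 'rV[R]_n | forall i, `|x ord0 i - q ord0 i| < r].
Proof.
rewrite (_ : [set x | _] = \bigcap_(i in [set: 'I_n])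
  ((fun x : 'rV[R]_n => `|x ord0 i - q ord0 i|) @^-1` `]-oo, r[)); last first.
  by apply/seteqP; split=> x /= Ax i; [move=> _|have := Ax i Logic.I];
    rewrite ?in_itv//=; exact: Ax.
apply: fin_bigcap_measurable => // i _; rewrite -[X in measurable X]setTI.
have mi : measurable_fun setT (fun x : 'rV[R]_n => `|x ord0 i - q ord0 i|).
  apply: (measurableT_comp (@normr_measurable _ setT)) => //.
  by apply: measurable_funB => //; exact: measurable_coord.
by apply: mi.
Qed.

(** The measurable sets are generated by the coordinates, while continuity refers to the sup norm,
    whose balls are cubes: an open set is the union of the countably many cubes of rational centre
    and radius 1/(k+1) that it contains. *)
Lemma open_measurable_rV (U : set 'rV[R]_n) : open U -> measurable U.
Proof.
move=> oU.
pose cube (p : 'rV[rat]_n * nat) : set 'rV[R]_n :=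
  [set x | forall i, `|x ord0 i - map_mx ratr p.1 ord0 i| < p.2.+1%:R^-1].
pose F p := if `[< cube p `<=` U >] then cube p else set0.
rewrite (_ : U = \bigcup_p F p); last first.
  apply/seteqP; split=> [x Ux|x [p _]]; last first.
    by rewrite /F; case: asboolP => // h /h.
  have /nbhs_ballP[e /= e0 xe] : nbhs x U by exact: open_nbhs_nbhs.
  (* The half leaves room for two moves: from x to the rational centre, and from the centre to any
     point of the cube. *)
  have [k hk] : exists k, 0 + k.+1%:R^-1 < e / 2.
    by apply/ltr_add_invr; rewrite divr_gt0.
  rewrite add0r in hk.
  have /choice[q hq] (i : 'I_n) : exists q : rat, `|x ord0 i - ratr q| < k.+1%:R^-1.
    have /rat_in_itvoo[q] : x ord0 i - k.+1%:R^-1 < x ord0 i + k.+1%:R^-1.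
      by rewrite ltrBlDr -addrA ltrDl addr_gt0.
    rewrite in_itv /= => /andP[q1 q2]; exists q.
    move: q1 q2; move: (ratr q) (k.+1%:R^-1) (x ord0 i) => u v w q1 q2.
    by rewrite ltr_norml; apply/andP; split; lra.
  have xq : cube (\row_i q i, k) x by move=> i /=; rewrite !mxE.
  exists (\row_i q i, k) => //; rewrite /F; case: asboolP => // -[] y /= yq.
  apply: xe; split => // i j; rewrite (ord1 i) /ball /=.
  have h1 := xq j; have h2 := yq j; rewrite /= in h1 h2.
  rewrite (_ : x ord0 j - y ord0 j = (x ord0 j - map_mx ratr (\row_i q i) ord0 j) -
    (y ord0 j - map_mx ratr (\row_i q i) ord0 j)); last by ring.
  apply: le_lt_trans (ler_normB _ _) (lt_trans (ltrD h1 h2) _).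
  by move: hk; move: (k.+1%:R^-1) => v; lra.
apply: countable_bigcupT_measurable; first exact: countableP.
move=> p; rewrite /F; case: asboolP => _ //; exact: measurable_rV_cube.
Qed.

Lemma continuous_measurable_rV (f : 'rV[R]_n -> R) :
  continuous f -> measurable_fun setT f.
Proof.
move=> /continuousP cf; apply: (measurability _ (RGenOpens.measurableE R)).
move=> _ [_ [a [b ->] <-]]; rewrite setTI; apply: open_measurable_rV.
exact/cf/interval_open.
Qed.

Lemma measurable_dotv : jointly_measurable (@dotv R n).
Proof.
apply: measurable_sum => i; apply: measurable_funM.
- exact: (measurableT_comp (measurable_coord i) measurable_fst).
- exact: (measurableT_comp (measurable_coord i) measurable_snd).
Qed.

Lemma measurable_enorm : measurable_fun setT (@enorm R n).
Proof.
apply: (measurableT_comp (continuous_measurable_fun (@sqrt_continuous R))).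
apply: (@measurable_joint_comp _ _ _ _ _ _ _ (@dotv R n) id id) => //.
exact: measurable_dotv.
Qed.

End borel_sets_rV.

(** * The Bessel inequality in dimension n *)

Section bessel_rV.
Context (R : realType).
Local Notation leb := (@lebesgue_measure R).

Definition box n (k : R) (x : 'rV[R]_n) : R := \prod_(i < n) box1 k (x ord0 i).

Lemma box_cons n k p : box k (@rV_cons R n p) = box1 k p.1 * box k p.2.
Proof.
rewrite /box big_ord_recl rV_cons0; congr (_ * _).
by apply: eq_bigr => i _; rewrite rV_cons_lift.
Qed.

Lemma box_01 n k (x : 'rV[R]_n) : 0 <= box k x <= 1.
Proof.
rewrite /box; elim/big_rec: _ => [|i y _ /andP[y0 y1]]; first by rewrite ler01 lexx.
by have /andP[b0 b1] := box1_01 k (x ord0 i); rewrite mulr_ge0 ?mulr_ile1.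
Qed.

Lemma box_eq1 n k (x : 'rV[R]_n) : (forall i, `|x ord0 i| <= k) -> box k x = 1.
Proof.
by move=> xk; rewrite /box big1// => i _; rewrite box1E -ler_norml xk.
Qed.

Lemma measurable_box n k : measurable_fun setT (@box n k).
Proof.
rewrite /box; elim: (index_enum _) => [|i s IHs].
  by under eq_fun do rewrite big_nil; exact: measurable_cst.
under eq_fun do rewrite big_cons.
apply: measurable_funM => //.
exact: (measurableT_comp (measurable_box1 k) (measurable_coord i)).
Qed.

Lemma dotv_cons n (p q : measurableTypeR R * 'rV[R]_n) :
  dotv (rV_cons p) (rV_cons q) = line_phase p.1 q.1 + dotv p.2 q.2.
Proof.
rewrite /dotv big_ord_recl !rV_cons0; congr (_ + _).
by apply: eq_bigr => i _; rewrite !rV_cons_lift.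
Qed.

Lemma ge0_integral_rV_cons n (f : 'rV[R]_n.+1 -> \bar R) :
  measurable_fun setT f -> (forall x, 0 <= f x)%E ->
  (\int[lebesgue_rV R n.+1]_x f x =
   \int[(leb \x lebesgue_rV R n)%E]_p f (rV_cons p))%E.
Proof.
move=> mf f0.
by apply: (ge0_integral_pushforward (@measurable_rV_cons R n)).
Qed.

Lemma integrable_rV_cons n (f : 'rV[R]_n.+1 -> R) : measurable_fun setT f ->
  (leb \x lebesgue_rV R n)%E.-integrable setT (EFin \o (fun p => f (rV_cons p))) ->
  (lebesgue_rV R n.+1).-integrable setT (EFin \o f).
Proof.
move=> mf fi; apply: (integrable_pushforward (@measurable_rV_cons R n)) => //.
exact/measurable_EFinP.
Qed.

Lemma Rintegral_rV_cons n (f : 'rV[R]_n.+1 -> R) : measurable_fun setT f ->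
  (leb \x lebesgue_rV R n)%E.-integrable setT (EFin \o (fun p => f (rV_cons p))) ->
  \int[lebesgue_rV R n.+1]_x f x =
  \int[(leb \x lebesgue_rV R n)%E]_p f (rV_cons p).
Proof.
move=> mf fi; congr fine.
apply: (integral_pushforward (@measurable_rV_cons R n)) => //.
exact/measurable_EFinP.
Qed.

Lemma window_box n k : window (lebesgue_rV R n) (box k).
Proof.
split; [exact: measurable_box| |exact: box_01].
elim: n => [|n IHn]; last first.
  apply: integrable_rV_cons; first exact: measurable_box.
  under [X in _ \o X]eq_fun do rewrite box_cons.
  by apply: integrable_tensor => //; exact: integrable_itv_indic.
apply/integrableP; split; first by apply/measurable_EFinP; exact: measurable_box.
have mb : measurable_fun setT (fun x : 'rV[R]_0 => `|(EFin \o box k) x|%E).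
  apply/measurable_EFinP; apply: (measurableT_comp (@normr_measurable _ setT)).
  exact: measurable_box.
have := integral_dirac (0 : 'rV[R]_0) measurableT mb => /= ->.
by rewrite diracE mem_set// mul1e ltry.
Qed.

(** Base of the induction: the measure is a point mass, and the transform is multiplication by cos
    c. *)
Lemma bessel_rV0 k : bessel (lebesgue_rV R 0) (lebesgue_rV R 0) (@dotv R 0) (box k) 1.
Proof.
move=> g c tg; have [mg [L gL]] := tg.
have mosc : measurable_fun setT (osc (lebesgue_rV R 0) (@dotv R 0) (cst c) g).
  by apply: measurable_osc => //; exact: measurable_dotv.
have m1 : measurable_fun setT (fun x =>
    (osc (lebesgue_rV R 0) (@dotv R 0) (cst c) g x ^+ 2)%:E).
  by apply/measurable_EFinP; exact: measurable_funX.
have m2 : measurable_fun setT (fun x => (g x ^+ 2)%:E).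
  by apply/measurable_EFinP; exact: measurable_funX.
have m3 : measurable_fun setT (fun y : 'rV[R]_0 =>
    (cos (dotv (0 : 'rV[R]_0) y + cst c y) * g y)%:E).
  apply/measurable_EFinP; apply: measurable_funM => //.
  apply: measurable_fun_cos; apply: measurable_funD => //.
  exact: jointly_measurable1 (@measurable_dotv R 0).
have := integral_dirac (0 : 'rV[R]_0) measurableT m1 => /= ->.
have := integral_dirac (0 : 'rV[R]_0) measurableT m2 => /= ->.
rewrite diracE mem_set// !mul1e lee_fin /osc /Rintegral.
have := integral_dirac (0 : 'rV[R]_0) measurableT m3 => /= ->.
rewrite diracE mem_set// mul1e /= exprMn ler_piMl ?sqr_ge0//.
Qed.

(** Each coordinate multiplies the constant by 4 (10 pi): 10 pi from the line and 4 from the tensor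
    step. Independence of k is what allows the box to be exhausted later. *)
Lemma bessel_rV n k : 0 < k ->
  bessel (lebesgue_rV R n) (lebesgue_rV R n) (@dotv R n) (box k) ((40 * pi) ^+ n).
Proof.
move=> k0; elim: n => [|n IHn]; first by rewrite expr0; exact: bessel_rV0.
have pi0 : 0 <= 10 * pi :> R by rewrite mulr_ge0// pi_ge0.
have c0 : 0 <= (40 * pi) ^+ n :> R by rewrite exprn_ge0// mulr_ge0// pi_ge0.
have B := bessel_prod (mu1 := leb) (nu1 := leb) (mu2 := lebesgue_rV R n)
  (nu2 := lebesgue_rV R n) (@measurable_line_phase R) (@measurable_dotv R n)
  (window_box1 k) (window_box n k) pi0 c0 (bessel_line k0) IHn.
move=> g c tg; have [mg [L gL]] := tg.
have mosc : measurable_fun setT (osc (lebesgue_rV R n.+1) (@dotv R n.+1) (cst c) g).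
  by apply: measurable_osc => //; exact: measurable_dotv.
have sq0 (z : R) : (0 <= (z ^+ 2)%:E)%E by rewrite lee_fin sqr_ge0.
pose h p := g (rV_cons p).
have th : tame (tensor (box1 k) (box k)) h.
  split; first exact: (measurableT_comp mg (@measurable_rV_cons R n)).
  by exists L => p; rewrite /tensor -box_cons; exact: gL.
rewrite !ge0_integral_rV_cons//; last 2 first.
- by apply/measurable_EFinP; exact: measurable_funX.
- by apply/measurable_EFinP; exact: measurable_funX.
rewrite (_ : (40 * pi) ^+ n.+1 = 4 * (10 * pi) * (40 * pi) ^+ n); last first.
  by rewrite exprS; ring.
have oscE p : osc (lebesgue_rV R n.+1) (@dotv R n.+1) (cst c) g (rV_cons p) =
    osc (leb \x lebesgue_rV R n)%E (phase_sum (@line_phase R) (@dotv R n)) (cst c) h p.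
  rewrite /osc Rintegral_rV_cons.
  - by apply: eq_Rintegral => q _; rewrite dotv_cons.
  - apply: measurable_funM => //; apply: measurable_fun_cos.
    by apply: measurable_funD => //; exact: jointly_measurable1 (@measurable_dotv R _).
  - under [X in _ \o X]eq_fun do rewrite dotv_cons.
    have mp : jointly_measurable (phase_sum (@line_phase R) (@dotv R n)).
      apply: measurable_funD.
        apply: (measurable_joint_comp (@measurable_line_phase R)) => //.
          by apply: measurableT_comp => //; exact: measurable_fst.
        by apply: measurableT_comp => //; exact: measurable_fst.
      apply: (measurable_joint_comp (@measurable_dotv R n)) => //.
        by apply: measurableT_comp => //; exact: measurable_snd.
      by apply: measurableT_comp => //; exact: measurable_snd.
    exact: (osc_integrable p (window_tensor (window_box1 k) (window_box n k)) th mp).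
under eq_integral => p _ do rewrite oscE.
exact: B.
Qed.

End bessel_rV.

(** * Square-integrable majorants of families of functions *)

Section dominated_families.
Context d (X : measurableType d) (R : realType) (T : Type).
Variable mu : {measure set X -> \bar R}.
Implicit Types (Phi Psi : T -> X -> R) (E : set T) (C : \bar R).

(** An L^2 bound for the supremum over E that does not ask this supremum to be measurable: [H] is a
    measurable majorant of all the squares. *)
Definition dominated Phi E C := exists H : X -> \bar R,
  [/\ measurable_fun setT H, forall x, (0 <= H x)%E,
      forall t x, E t -> ((Phi t x ^+ 2)%:E <= H x)%E &
      (\int[mu]_x H x <= C)%E].

Lemma dominated_le Phi E C C' : (C <= C')%E -> dominated Phi E C ->
  dominated Phi E C'.
Proof.
by move=> CC' [H [mH H0 PH HC]]; exists H; split=> //; exact: le_trans HC CC'.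
Qed.

Lemma le_limn_einf (u v : (\bar R)^nat) : (forall k, u k <= v k)%E ->
  (limn_einf u <= limn_einf v)%E.
Proof.
move=> uv; rewrite !limn_einf_lim; apply: lee_lim; try exact: is_cvg_einfs.
apply: nearW => n; apply: le_ereal_inf_tmp => _ [m /= nm <-].
by apply: le_trans (uv m); apply: ereal_inf_lbound; exists m.
Qed.

(* Fatou; the second alternative covers the points at which the limit integral
   does not exist and is 0 by convention. *)
Lemma dominated_lim (Phi_ : nat -> T -> X -> R) Phi E C :
  (forall k, dominated (Phi_ k) E C) ->
  (forall t x, E t -> (Phi_ k t x @[k --> \oo] --> Phi t x) \/ Phi t x = 0) ->
  dominated Phi E C.
Proof.
move=> /choice[H hH] lim.
have H0 x : (0 <= limn_einf (fun k => H k x))%E.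
  rewrite -[leLHS](cvg_limn_einf_sup (cvg_cst (0%E : \bar R))).1.
  by apply: le_limn_einf => k; have [_ + _ _] := hH k; exact.
exists (fun x => limn_einf (fun k => H k x)); split.
- by apply: measurable_limn_einf => k; have [] := hH k.
- exact: H0.
- move=> t x Et; have [cv|->] := lim t x Et; last by rewrite expr0n.
  have cv2 : (fun k => (Phi_ k t x ^+ 2)%:E) @ \oo --> (Phi t x ^+ 2)%:E.
    by apply: cvg_EFin; [exact: nearW|exact: (cvgM cv cv)].
  rewrite -(cvg_limn_einf_sup cv2).1; apply: le_limn_einf => k.
  by have [_ _ + _] := hH k; exact.
- by apply: integral_limn_einf_le => k; have [] := hH k.
Qed.

(** The sum of the majorants of the pieces serves every t at once. The factor N is how the covering
    number enters the estimate. *)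
Lemma dominated_union Phi E N (F : 'I_N -> set T) C :
  (forall l, dominated Phi (F l) C) -> E `<=` \bigcup_l F l ->
  dominated Phi E (N%:R%:E * C)%E.
Proof.
move=> /choice[H hH] EF; exists (fun x => \sum_(l < N) H l x)%E.
have mH l : measurable_fun setT (H l) by have [] := hH l.
have H0 l x : (0 <= H l x)%E by have [] := hH l.
split.
- exact: emeasurable_sum.
- by move=> x; exact: sume_ge0.
- move=> t x /EF[l _ Flt]; rewrite (bigD1 l)//=.
  have [_ _ h _] := hH l; apply: le_trans (h t x Flt) _.
  by rewrite leeDl// sume_ge0.
- rewrite ge0_integral_sum//.
  apply: (@le_trans _ _ (\sum_(l < N) C)%E).
    by apply: lee_sum => l _; have [] := hH l.
  by rewrite sumr_const card_ord mule_natl.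
Qed.

Lemma weighted_cauchy_schwarz (b p : nat -> R) M : (forall m, 0 < p m) ->
  (\sum_(m < M) b m) ^+ 2 <=
  (\sum_(m < M) p m) * (\sum_(m < M) (p m)^-1 * b m ^+ 2).
Proof.
move=> p0; elim: M => [|M IHM]; first by rewrite !big_ord0 mul0r expr0n.
have P0 : 0 <= \sum_(m < M) p m by apply: sumr_ge0 => i _; exact: ltW.
have Q0 : 0 <= \sum_(m < M) (p m)^-1 * b m ^+ 2.
  by apply: sumr_ge0 => i _; rewrite mulr_ge0 ?invr_ge0 ?sqr_ge0 ?(ltW (p0 _)).
rewrite !big_ord_recr /=; move: IHM P0 Q0.
set B := \sum_(m < M) b m; set P := \sum_(m < M) p m.
set Q := \sum_(m < M) _; move=> IHM P0 Q0.
(* [u] and [v] are the cross terms of the expanded product. [2 * (B * b M)] is at most [u + v]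
   because (B b)^2 <= u v and 4 u v <= (u + v)^2. *)
have pM := p0 M; set u := P * ((p M)^-1 * b M ^+ 2); set v := p M * Q.
have u0 : 0 <= u by rewrite mulr_ge0// mulr_ge0 ?invr_ge0 ?sqr_ge0 ?(ltW pM).
have v0 : 0 <= v by rewrite mulr_ge0 ?(ltW pM).
have uv : (B * b M) ^+ 2 <= u * v.
  rewrite (_ : u * v = P * Q * b M ^+ 2); last first.
    by rewrite /u /v; field; rewrite gt_eqF.
  by rewrite exprMn ler_wpM2r// sqr_ge0.
have key : 2 * (B * b M) <= u + v.
  apply: le_trans (ler_norm _) _.
  rewrite -[leRHS]ger0_norm ?addr_ge0// -ler_sqr ?nnegrE ?normr_ge0//.
  rewrite !real_normK ?num_real// exprMn.
  by have := sqr_ge0 (u - v); nra.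
have -> : (P + p M) * (Q + (p M)^-1 * b M ^+ 2) = P * Q + u + v + b M ^+ 2.
  by rewrite /u /v; field; rewrite gt_eqF.
by nra.
Qed.

(** Pointwise weighted Cauchy-Schwarz. The weights stay free until the cost of covering each band is
    known. *)
Lemma dominated_wsum (Phi_ : nat -> T -> X -> R) Phi E M (p : nat -> R)
    (C : nat -> \bar R) : (forall m, 0 < p m) ->
  (forall m, dominated (Phi_ m) E (C m)) ->
  (forall t x, E t -> Phi t x = \sum_(m < M) Phi_ m t x) ->
  dominated Phi E
    ((\sum_(m < M) p m)%:E * \sum_(m < M) (p m)^-1%:E * C m)%E.
Proof.
move=> p0 /choice[H hH] PhiE.
have mH l : measurable_fun setT (H l) by have [] := hH l.
have H0 l x : (0 <= H l x)%E by have [] := hH l.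
have P0 : 0 <= \sum_(m < M) p m by apply: sumr_ge0 => i _; exact: ltW.
have mpH l : measurable_fun setT (fun x => (p l)^-1%:E * H l x)%E.
  exact: measurable_funeM.
have pH0 l x : (0 <= (p l)^-1%:E * H l x)%E.
  by rewrite mule_ge0// lee_fin invr_ge0 ltW.
have mS : measurable_fun setT (fun x => \sum_(m < M) (p m)^-1%:E * H m x)%E.
  exact: emeasurable_sum.
exists (fun x => (\sum_(m < M) p m)%:E * \sum_(m < M) (p m)^-1%:E * H m x)%E; split.
- exact: measurable_funeM.
- by move=> x; rewrite mule_ge0 ?lee_fin// sume_ge0.
- move=> t x Et; rewrite PhiE//.
  apply: (@le_trans _ _ ((\sum_(m < M) p m)%:E *
      \sum_(m < M) (p m)^-1%:E * (Phi_ m t x ^+ 2)%:E)%E).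
    under [X in (_ <= _ * X)%E]eq_bigr do rewrite -EFinM.
    rewrite sumEFin -EFinM lee_fin.
    exact: (weighted_cauchy_schwarz (fun m => Phi_ m t x)).
  rewrite lee_wpmul2l ?lee_fin//; apply: lee_sum => m _.
  rewrite lee_wpmul2l ?lee_fin ?invr_ge0 ?(ltW (p0 _))//.
  by have [_ _ + _] := hH m; exact.
- rewrite ge0_integralZl_EFin//; last by move=> x _; exact: sume_ge0.
  rewrite lee_wpmul2l ?lee_fin// ge0_integral_sum//.
  apply: lee_sum => m _; rewrite ge0_integralZl_EFin ?invr_ge0 ?(ltW (p0 _))//.
  rewrite lee_wpmul2l ?lee_fin ?invr_ge0 ?(ltW (p0 _))//.
  by have [] := hH m.
Qed.

Lemma dominatedB Phi Psi E C C' : dominated Phi E C -> dominated Psi E C' ->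
  dominated (fun t x => Phi t x - Psi t x) E (2%:E * C + 2%:E * C')%E.
Proof.
move=> [H [mH H0 PH HC]] [K [mK K0 PK KC]].
have mH2 : measurable_fun setT (fun x => 2%:E * H x)%E by exact: measurable_funeM.
have mK2 : measurable_fun setT (fun x => 2%:E * K x)%E by exact: measurable_funeM.
have H20 x : (0 <= 2%:E * H x)%E by rewrite mule_ge0.
have K20 x : (0 <= 2%:E * K x)%E by rewrite mule_ge0.
exists (fun x => 2%:E * H x + 2%:E * K x)%E; split.
- exact: emeasurable_funD.
- by move=> x; rewrite adde_ge0.
- move=> t x Et.
  apply: (@le_trans _ _ (2%:E * (Phi t x ^+ 2)%:E + 2%:E * (Psi t x ^+ 2)%:E)%E).
    rewrite -!EFinM -EFinD lee_fin.
    by have := sqr_ge0 (Phi t x + Psi t x); nra.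
  by apply: leeD; rewrite lee_pmul2l ?lte_fin//; [exact: PH|exact: PK].
- rewrite ge0_integralD//; apply: leeD; rewrite ge0_integralZl_EFin// lee_pmul2l ?lte_fin//.
Qed.

End dominated_families.

(** * Estimates in time and the dyadic decomposition *)

Section interval_cauchy_schwarz.
Context (R : realType).
Local Notation leb := (@lebesgue_measure R).

Lemma indic_itv_integrable (a b M : R) (h : R -> R) : measurable_fun setT h ->
  (forall s, `|h s| <= M) ->
  leb.-integrable setT (EFin \o (fun s => \1_`[a, b] s * h s)).
Proof.
move=> mh hM; apply: (@dom_integrable _ _ _ leb _ (fun s => M * \1_`[a, b] s)).
- by apply: measurable_funM => //; exact: measurable_itv_indic.
- by apply: integrable_Rscale; exact: integrable_itv_indic.
- by move=> s; rewrite normrM mulrC ler_pM// indicE normr_nat.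
Qed.

(** Expands the nonnegative integral of (h - r)^2 over the interval, where [r] is the mean of [h].
    An interval reduced to a point has no mean and is treated apart. *)
Lemma sqr_Rintegral_indic_le (a b M : R) (h : R -> R) : a <= b ->
  measurable_fun setT h -> (forall s, `|h s| <= M) ->
  (\int[leb]_s (\1_`[a, b] s * h s)) ^+ 2 <=
  (b - a) * \int[leb]_s (\1_`[a, b] s * h s ^+ 2).
Proof.
rewrite le_eqVlt => /predU1P[<-|ab] mh hM.
  by rewrite -!Rintegral_indicl set_itv1 !Rintegral_set1 expr0n mulr0.
have ba : 0 < b - a by rewrite subr_gt0.
set A := \int[leb]_s _; set Q := \int[leb]_s _; pose r := A / (b - a).
have ih := indic_itv_integrable a b mh hM.
have mh2 : measurable_fun setT (fun s => h s ^+ 2) by exact: measurable_funX.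
have hM2 s : `|h s ^+ 2| <= M ^+ 2.
  by rewrite normrX !expr2; exact: (ler_pM (normr_ge0 _) (normr_ge0 _)).
have ih2 := indic_itv_integrable a b mh2 hM2.
have i1 := integrable_itv_indic a b.
have : 0 <= \int[leb]_s (\1_`[a, b] s * h s ^+ 2 - 2 * r * (\1_`[a, b] s * h s) +
    r ^+ 2 * \1_`[a, b] s).
  apply: Rintegral_ge0 => s _.
  rewrite (_ : _ + _ = \1_`[a, b] s * (h s - r) ^+ 2); last by ring.
  by rewrite mulr_ge0 ?sqr_ge0// indicE.
have i2 := integrable_Rscale (2 * r) ih.
have iB := integrableB measurableT ih2 i2.
rewrite RintegralD//; last exact: integrable_Rscale.
rewrite RintegralB// !RintegralZl// integral_itv_indic ?(ltW ab)// -/A -/Q.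
have -> : Q - 2 * r * A + r ^+ 2 * (b - a) = Q - A ^+ 2 / (b - a).
  by rewrite /r; field; rewrite gt_eqF.
by rewrite subr_ge0 ler_pdivrMr// mulrC.
Qed.

End interval_cauchy_schwarz.

Section dyadic_frequencies.
Context d1 d2 (X : measurableType d1) (Y : measurableType d2) (R : realType).
Variables (mu : {sigma_finite_measure set X -> \bar R}).
Variables (nu : {sigma_finite_measure set Y -> \bar R}).
Variables (phi : X -> Y -> R) (b : Y -> R) (C : R).
Hypotheses (mphi : jointly_measurable phi) (wb : window nu b) (C0 : 0 <= C).
Hypothesis (HB : bessel mu nu phi b C).
Variables (lam : Y -> R).
Hypothesis (mlam : measurable_fun setT lam).
Local Notation leb := (@lebesgue_measure R).

(** Real form of the propagator with dispersion [lam], later |xi|^a, acting on a frequency profile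
    [g]. *)
Definition flow c g t x := osc nu phi (fun y => t * lam y + c) g x.

Let mphase t c : measurable_fun setT (fun y => t * lam y + c).
Proof. by apply: measurable_funD => //; apply: measurable_funM. Qed.

Lemma measurable_flow c g : measurable_fun setT g ->
  jointly_measurable (fun x t => flow c g t x).
Proof.
move=> mg; apply: (@measurable_Rintegral _ _ _ _ _ nu
  (fun (w : X * R) y => cos (phi w.1 y + (w.2 * lam y + c)) * g y)).
apply: measurable_funM; last exact: measurableT_comp mg measurable_snd.
apply: measurable_fun_cos; apply: measurable_funD.
  apply: (measurable_joint_comp mphi) => //.
  by apply: measurableT_comp => //; exact: measurable_fst.
apply: measurable_funD => //; apply: measurable_funM.
  by apply: measurableT_comp => //; exact: measurable_fst.
exact: measurableT_comp mlam measurable_snd.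
Qed.

Lemma flow_bessel c g t : tame b g ->
  (\int[mu]_x (flow c g t x ^+ 2)%:E <= (4 * C)%:E * \int[nu]_y (g y ^+ 2)%:E)%E.
Proof. by move=> tg; exact: (bessel_phase C0 wb tg mphi (mphase t c) HB). Qed.

Section time_interval.
Variables (g : Y -> R) (c Lam t0 delta : R).
Hypotheses (tg : tame b g) (Lam0 : 0 <= Lam).
Hypothesis (lamg : forall y, `|lam y * g y| <= Lam * `|g y|).
Hypotheses (delta0 : 0 < delta) (deltaLam : delta * Lam <= 1).

Let h y := lam y * g y.

Let th : tame b h.
Proof.
have [mg [L gL]] := tg; split; first exact: measurable_funM.
by exists (Lam * L) => y; apply: le_trans (lamg y) _; rewrite -mulrA ler_wpM2l.
Qed.

(** Minus the time derivative of [flow c g]: differentiating the cosine brings out [lam], absorbed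
    in [h], and minus a sine, which is minus the cosine shifted by -pi/2. *)
Let dflow := flow (c - pi / 2) h.

(** The fundamental theorem of calculus for each fixed y, then Fubini in (s, y), so that nothing is
    differentiated under an integral sign. The sign of [dflow] explains why the later value is
    subtracted from the earlier one. *)
Lemma flow_diff t x : t0 <= t -> flow c g t0 x - flow c g t x =
  \int[leb]_s (\1_`[t0, t] s * dflow s x).
Proof.
move=> t0t; have [mh [L hL]] := th; have [mb ib b01] := wb.
have ih s : nu.-integrable setT (EFin \o
    (fun y => cos (phi x y + (s * lam y + (c - pi / 2))) * h y)).
  exact: (osc_integrable x wb th mphi (mphase s (c - pi / 2))).
transitivity (\int[leb]_s \int[nu]_y
    (\1_`[t0, t] s * (cos (phi x y + (s * lam y + (c - pi / 2))) * h y))); last first.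
  by apply: eq_Rintegral => s _; rewrite RintegralZl.
rewrite (@rfubini _ _ _ _ _ leb nu _ (fun s => \1_`[t0, t] s)
  (fun y => L * b y))//; first last.
- move=> s y; rewrite normrM ler_pM//; first by rewrite indicE normr_nat.
  by rewrite normrM; apply: le_trans (hL y); rewrite ler_piMl// cos_max.
- exact: integrable_Rscale.
- exact: integrable_itv_indic.
- apply: measurable_funM.
    by apply: measurableT_comp => //; exact: measurable_itv_indic.
  apply: measurable_funM; last exact: measurableT_comp mh measurable_snd.
  apply: measurable_fun_cos; apply: measurable_funD.
    exact: measurableT_comp (jointly_measurable1 x mphi) measurable_snd.
  apply: measurable_funD => //; apply: measurable_funM => //.
  exact: measurableT_comp mlam measurable_snd.
rewrite /flow /osc -RintegralB//; last 2 first.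
- exact: (osc_integrable x wb tg mphi (mphase t0 c)).
- exact: (osc_integrable x wb tg mphi (mphase t c)).
apply: eq_Rintegral => y _; rewrite -Rintegral_indicl.
pose F s := - (cos (s * lam y + (phi x y + c)) * g y).
pose f s := cos (s * lam y + (phi x y + (c - pi / 2))) * h y.
have dF (s : R) : is_derive s 1 F (f s).
  apply: is_derive_eq.
  rewrite /f /h /GRing.scale /= (addrA (phi x y) c) (addrA (s * lam y) (phi x y + c)).
  by rewrite cosBpihalf; ring.
have cf : continuous f.
  by move=> s; apply: cvgM; [exact: cos_affine_continuous|exact: cvg_cst].
transitivity (F t - F t0).
  by rewrite /F opprK [RHS]addrC; congr (cos _ * _ - cos _ * _); ring.
rewrite -(Rintegral_FTC t0t dF cf).
apply: eq_Rintegral => s _; rewrite /f; congr (cos _ * _); ring.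
Qed.

(** 16 C = 8 C + 8 C: the initial value gives 2 (4 C), and the variation in time gives 2 delta *
    delta * 4 C Lam^2, at most 8 C because [delta * Lam <= 1]. *)
Lemma dominated_time_interval :
  dominated mu (flow c g) `[t0, t0 + delta]%classic
    ((16 * C)%:E * \int[nu]_y (g y ^+ 2)%:E)%E.
Proof.
have [mg _] := tg; have [mh [L hL]] := th; have [mb ib b01] := wb.
have mflow := measurable_flow c mg.
have mdflow : jointly_measurable (fun x s => dflow s x) by exact: measurable_flow.
pose M := \int[nu]_y (L * b y).
have dflow_le s x : `|dflow s x| <= M.
  apply: (@norm_Rintegral_le _ _ _ nu).
  - apply: measurable_funM => //; apply: measurable_fun_cos.
    by apply: measurable_funD; [exact: jointly_measurable1|exact: mphase].
  - exact: integrable_Rscale.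
  - by move=> y; rewrite normrM; apply: le_trans (hL y); rewrite ler_piMl// cos_max.
pose w s : R := \1_`[t0, t0 + delta] s.
have w0 s : 0 <= w s by rewrite /w indicE.
have mw : measurable_fun setT w by exact: measurable_itv_indic.
(* The integral runs over the whole interval, so [K] does not depend on t and can enter the
   majorant. *)
pose K x := (\int[leb]_s (w s * dflow s x ^+ 2)%:E)%E.
have mwd : measurable_fun setT (fun z : X * R => (w z.2 * dflow z.2 z.1 ^+ 2)%:E).
  apply/measurable_EFinP; apply: measurable_funM.
    exact: measurableT_comp mw measurable_snd.
  exact: measurable_funX.
have wd0 x s : (0 <= (w s * dflow s x ^+ 2)%:E)%E.
  by rewrite lee_fin mulr_ge0// sqr_ge0.
have mK : measurable_fun setT K.
  exact: (@ge0_measurable_integral _ _ _ _ _ leb (fun x s => (w s * dflow s x ^+ 2)%:E)).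
have K0 x : (0 <= K x)%E by exact: integral_ge0.
have mflow0 : measurable_fun setT (fun x => (flow c g t0 x ^+ 2)%:E).
  by apply/measurable_EFinP; apply: measurable_funX; exact: (jointly_measurable2 t0 mflow).
have flow00 x : (0 <= (flow c g t0 x ^+ 2)%:E)%E by rewrite lee_fin sqr_ge0.
have dd0 : 0 <= 2 * delta by rewrite mulr_ge0// (ltW delta0).
have m1 : measurable_fun setT (fun x => 2%:E * (flow c g t0 x ^+ 2)%:E)%E.
  exact: measurable_funeM.
have m2 : measurable_fun setT (fun x => (2 * delta)%:E * K x)%E.
  exact: measurable_funeM.
have p1 x : (0 <= 2%:E * (flow c g t0 x ^+ 2)%:E)%E by rewrite mule_ge0.
have p2 x : (0 <= (2 * delta)%:E * K x)%E by rewrite mule_ge0.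
exists (fun x => 2%:E * (flow c g t0 x ^+ 2)%:E + (2 * delta)%:E * K x)%E; split.
- exact: emeasurable_funD.
- by move=> x; rewrite adde_ge0.
- move=> t x /=; rewrite in_itv /= => /andP[t0t ttd].
  have md : measurable_fun setT (fun s => dflow s x).
    exact: (jointly_measurable1 x mdflow).
  have md2 : measurable_fun setT (fun s => dflow s x ^+ 2) by exact: measurable_funX.
  pose D := flow c g t0 x - flow c g t x.
  have DE : D = \int[leb]_s (\1_`[t0, t] s * dflow s x) by exact: flow_diff.
  have D2 : ((D ^+ 2)%:E <= delta%:E * K x)%E.
    have := sqr_Rintegral_indic_le t0t md (fun s => dflow_le s x).
    rewrite -DE => hD; apply: (@le_trans _ _ ((t - t0) *
      \int[leb]_s (\1_`[t0, t] s * dflow s x ^+ 2))%:E); first by rewrite lee_fin.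
    rewrite EFinM EFin_Rintegral; last first.
      apply: (indic_itv_integrable (M := M ^+ 2) t0 t md2) => s.
      by rewrite normrX !expr2; exact: (ler_pM (normr_ge0 _) (normr_ge0 _)).
    apply: lee_pmul.
    + by rewrite lee_fin subr_ge0.
    + by apply: integral_ge0 => s _; rewrite lee_fin mulr_ge0 ?sqr_ge0// indicE.
    + by rewrite lee_fin; lra.
    + apply: ge0_integral_le.
      * by apply/measurable_EFinP; apply: measurable_funM => //; exact: measurable_itv_indic.
      * by apply/measurable_EFinP; apply: measurable_funM.
      * by move=> s; rewrite lee_fin mulr_ge0 ?sqr_ge0// indicE.
      * move=> s; rewrite lee_fin ler_wpM2r ?sqr_ge0// /w !indicE !mem_setE !in_itv /=.
        case: (boolP (t0 <= s <= t)) => [/andP[? st]|_]; last by rewrite ler0n.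
        by rewrite (_ : t0 <= s <= t0 + delta)//; apply/andP; split => //; lra.
  apply: (@le_trans _ _ (2%:E * (flow c g t0 x ^+ 2)%:E + 2%:E * (D ^+ 2)%:E)%E).
    rewrite -!EFinM -EFinD lee_fin /D.
    (* With A the initial value, the flow at time t is A - D, and (A - D)^2 <= 2 A^2 + 2 D^2 amounts
       to (A + D)^2 >= 0. *)
    by have := sqr_ge0 (2 * flow c g t0 x - flow c g t x); nra.
  by rewrite leeD2l// (EFinM 2 delta) -muleA lee_pmul2l ?lte_fin.
- rewrite ge0_integralD// !ge0_integralZl_EFin//.
  set G2 := (\int[nu]_y _)%E.
  have G20 : (0 <= G2)%E by apply: integral_ge0 => y _; rewrite lee_fin sqr_ge0.
  have intK : (\int[mu]_x K x <= delta%:E * ((4 * C * Lam ^+ 2)%:E * G2))%E.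
    (* Exchanging x and s lets the Bessel inequality act at each fixed time; the integral in time
       then contributes only the length [delta]. *)
    rewrite /K (@tonelli_swap _ _ _ _ _ mu leb (fun x s => (w s * dflow s x ^+ 2)%:E))//.
    have -> : (delta%:E * ((4 * C * Lam ^+ 2)%:E * G2) =
        \int[leb]_s ((w s)%:E * ((4 * C * Lam ^+ 2)%:E * G2)))%E.
      have mwE : measurable_fun setT (EFin \o w) by exact/measurable_EFinP.
      have wE0 s : setT s -> (0 <= (EFin \o w) s)%E by move=> _ /=; rewrite lee_fin.
      have c0 : (0 <= (4 * C * Lam ^+ 2)%:E * G2)%E.
        by rewrite mule_ge0// lee_fin !mulr_ge0// sqr_ge0.
      rewrite (ge0_integralZr leb measurableT mwE wE0 c0).
      congr (_ * _)%E; rewrite -EFin_Rintegral; last exact: integrable_itv_indic.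
      by congr EFin; rewrite /w integral_itv_indic; lra.
    apply: ge0_integral_le.
    - exact: (@ge0_measurable_integral2 _ _ _ _ _ mu (fun x s => (w s * dflow s x ^+ 2)%:E)).
    - apply: emeasurable_funM => //; exact/measurable_EFinP.
    - by move=> s; exact: integral_ge0.
    - move=> s; under eq_integral do rewrite EFinM.
      rewrite ge0_integralZl_EFin//; first last.
      + apply/measurable_EFinP; apply: measurable_funX.
        exact: (jointly_measurable2 s mdflow).
      + by move=> x _; rewrite lee_fin sqr_ge0.
      rewrite lee_wpmul2l ?lee_fin//.
      apply: le_trans (flow_bessel (c - pi / 2) s th) _.
      rewrite (EFinM (4 * C)) -muleA lee_wpmul2l ?lee_fin ?mulr_ge0//.
      rewrite -ge0_integralZl_EFin ?sqr_ge0//; first last.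
      + by apply/measurable_EFinP; exact: measurable_funX.
      + by move=> y _; rewrite lee_fin sqr_ge0.
      apply: ge0_integral_le.
      + by apply/measurable_EFinP; exact: measurable_funX.
      + by apply: measurable_funeM; apply/measurable_EFinP; exact: measurable_funX.
      + by move=> y; rewrite lee_fin sqr_ge0.
      + move=> y; rewrite -EFinM lee_fin.
        rewrite -[X in X <= _]real_normK ?num_real//.
        rewrite -[X in _ * X]real_normK ?num_real// -exprMn !expr2.
        by apply: ler_pM => //; exact: lamg.
  have -> : ((16 * C)%:E * G2 = 2%:E * ((4 * C)%:E * G2) + (8 * C)%:E * G2)%E.
    rewrite muleA -ge0_muleDl ?mule_ge0 ?lee_fin ?mulr_ge0//.
    by rewrite -EFinM -EFinD; congr (_%:E * _)%E; ring.
  apply: leeD; first by rewrite lee_pmul2l ?lte_fin//; exact: flow_bessel.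
  apply: (@le_trans _ _ ((2 * delta)%:E * (delta%:E * ((4 * C * Lam ^+ 2)%:E * G2)))%E).
    by rewrite lee_wpmul2l ?lee_fin.
  rewrite !muleA -!EFinM lee_wpmul2r// lee_fin.
  rewrite (_ : 2 * delta * delta * (4 * C * Lam ^+ 2) =
    8 * C * (delta * Lam) ^+ 2); last by ring.
  by rewrite ler_piMr ?mulr_ge0// exprn_ile1// mulr_ge0// (ltW delta0).
Qed.

End time_interval.

Section annuli.
Hypothesis (lam0 : forall y, 0 <= lam y).

(** Dyadic in the dispersion rather than in |xi|: on band m the oscillation in time has frequency at
    most 2^m, which matches intervals of length 2^-m. Band 0 collects all low frequencies. *)
Definition band (m : nat) : interval R :=
  if m is m'.+1 then `]2 ^+ m', 2 ^+ m] else `]-oo, 1].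

Definition annulus m y : R := \1_([set` band m]) (lam y).

Lemma annulusE m y : annulus m y = (lam y \in band m)%:R.
Proof. by rewrite /annulus indicE mem_setE. Qed.

Lemma measurable_annulus m : measurable_fun setT (annulus m).
Proof. exact: (measurableT_comp (measurable_itv_indic (band m))). Qed.

Lemma annulus_sqr m y : annulus m y ^+ 2 = annulus m y.
Proof. by rewrite annulusE; case: (_ \in _); rewrite ?expr1n ?expr0n. Qed.

Lemma norm_annulus_le1 m y : `|annulus m y| <= 1.
Proof. by rewrite annulusE; case: (_ \in _); rewrite ?normr1 ?normr0. Qed.

Lemma sum_annulus M y : \sum_(m < M.+1) annulus m y = (lam y <= 2 ^+ M)%R%:R.
Proof.
elim: M => [|M IHM].
  by rewrite big_ord_recr big_ord0 /= add0r annulusE /= in_itv /= expr0.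
rewrite big_ord_recr /= IHM annulusE /= in_itv /= ltNge.
have M2 : 2 ^+ M <= 2 ^+ M.+1 :> R by rewrite ler_eXn2l// ltr1n.
case: (boolP (lam y <= 2 ^+ M)) => h /=; last by rewrite add0r.
by rewrite addr0 (le_trans h M2).
Qed.

Lemma annulus_le m y : annulus m y != 0 -> lam y <= 2 ^+ m.
Proof.
rewrite annulusE; case: m => [|m] /=; rewrite in_itv /= ?expr0.
  by case: (_ <= _); rewrite ?eqxx.
by case: (boolP (_ < _ <= _)) => [/andP[]//|]; rewrite eqxx.
Qed.

Lemma tame_sum (h : nat -> Y -> R) M : (forall m, tame b (h m)) ->
  tame b (fun y => \sum_(m < M) h m y).
Proof.
move=> th; split; first by apply: measurable_sum => m; exact: tame_measurable (th m).
elim: M => [|M [L hL]].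
  by exists 0 => y; rewrite big_ord0 normr0 mul0r.
have [_ [L' hL']] := th M; exists (L + L') => y.
rewrite big_ord_recr /= mulrDl; apply: le_trans (ler_normD _ _) _.
by apply: lerD.
Qed.

Lemma flow_sum c (h : nat -> Y -> R) M t x : (forall m, tame b (h m)) ->
  flow c (fun y => \sum_(m < M) h m y) t x = \sum_(m < M) flow c (h m) t x.
Proof.
move=> th; elim: M => [|M IHM].
  rewrite big_ord0 /flow /osc /Rintegral.
  under eq_integral do rewrite big_ord0 mulr0.
  by rewrite integral0.
rewrite big_ord_recr /= -IHM /flow /osc -RintegralD//.
- by apply: eq_Rintegral => y _; rewrite big_ord_recr /= mulrDr.
- exact: (osc_integrable x wb (tame_sum M th) mphi (mphase t c)).
- exact: (osc_integrable x wb (th M) mphi (mphase t c)).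
Qed.

(** The weights are p_m = N_m q_m. The union bound costs N_m on band m, and p_m^-1 N_m = q_m^-1: the
    covering numbers survive only in the sum of the weights, and [W] absorbs q_m^-1 on the band. *)
Lemma dominated_dyadic_sum g c M (E : set R) (N : nat -> nat) (q : nat -> R) (W : Y -> R) :
  tame b g -> (forall y, 2 ^+ M < lam y -> g y = 0) ->
  measurable_fun setT W -> (forall y, 0 <= W y) ->
  (forall m, 0 < q m) -> (forall m, (0 < N m)%N) ->
  (forall m, exists t0 : 'I_(N m) -> R,
    E `<=` \bigcup_l `[t0 l, t0 l + 2 ^- m]%classic) ->
  (forall m y, lam y \in band m -> (q m)^-1 <= W y) ->
  dominated mu (flow c g) E ((\sum_(m < M.+1) (N m)%:R * q m)%:E *
    ((16 * C)%:E * \int[nu]_y (W y * g y ^+ 2)%:E))%E.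
Proof.
move=> tg gM mW W0 q0 N0 cover qW.
have mg := tame_measurable tg.
pose h m y := annulus m y * g y.
have th m : tame b (h m).
  apply: (tameM (M := 1) wb tg); first exact: measurable_annulus.
  exact: norm_annulus_le1.
have gE : g = fun y => \sum_(m < M.+1) h m y.
  apply/funext => y; rewrite -mulr_suml sum_annulus.
  by case: (leP (lam y) (2 ^+ M)) => [_|/gM ->]; rewrite ?mul1r ?mulr0.
have C16 : 0 <= 16 * C by rewrite mulr_ge0.
have mh2 m : measurable_fun setT (fun y => (h m y ^+ 2)%:E).
  by apply/measurable_EFinP; apply: measurable_funX; exact: tame_measurable (th m).
have h20 m y : (0 <= (h m y ^+ 2)%:E)%E by rewrite lee_fin sqr_ge0.
have dom m : dominated mu (flow c (h m)) E
    ((N m)%:R%:E * ((16 * C)%:E * \int[nu]_y (h m y ^+ 2)%:E))%E.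
  have [t0 Et0] := cover m.
  apply: (@dominated_union _ _ _ _ _ _ _ _ (fun l => `[t0 l, t0 l + 2 ^- m]%classic)) => // l.
  (* [Lam] is [2 ^+ m] and [delta] is [2 ^- m], so [delta * Lam] is exactly 1. *)
  apply: (@dominated_time_interval _ _ (2 ^+ m)).
  - exact: th.
  - exact: exprn_ge0.
  - move=> y; rewrite normrM /h; have [->|/annulus_le lm] := eqVneq (annulus m y) 0.
      by rewrite mul0r normr0 !mulr0.
    by rewrite ler_wpM2r// ger0_norm.
  - by rewrite invr_gt0 exprn_gt0.
  - by rewrite mulVf// expf_neq0.
have p0 m : 0 < (N m)%:R * q m by rewrite mulr_gt0// ltr0n.
apply: dominated_le; last first.
  apply: (dominated_wsum (M := M.+1) p0 dom) => t x _.
  by rewrite {1}gE flow_sum.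
rewrite lee_wpmul2l ?lee_fin//; first by apply: sumr_ge0 => m _; exact: ltW.
have mqh m : measurable_fun setT (fun y => ((q m)^-1 * h m y ^+ 2)%:E).
  apply/measurable_EFinP; apply: measurable_funM => //; apply: measurable_funX.
  exact: tame_measurable (th m).
have qh0 m y : (0 <= ((q m)^-1 * h m y ^+ 2)%:E)%E.
  by rewrite lee_fin mulr_ge0 ?sqr_ge0// invr_ge0 ltW.
have -> : (\sum_(m < M.+1) ((N m)%:R * q m)^-1%:E *
    ((N m)%:R%:E * ((16 * C)%:E * \int[nu]_y (h m y ^+ 2)%:E)) =
    (16 * C)%:E * \int[nu]_y \sum_(m < M.+1) ((q m)^-1 * h m y ^+ 2)%:E)%E.
  rewrite ge0_integral_sum// ge0_sume_distrr; last by move=> m _; exact: integral_ge0.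
  apply: eq_bigr => m _; rewrite !muleA -!EFinM.
  have -> : ((N m)%:R * q m)^-1 * (N m)%:R * (16 * C) = 16 * C * (q m)^-1.
    by field; rewrite gt_eqF ?q0//= pnatr_eq0 -lt0n N0.
  rewrite EFinM -muleA; congr (_ * _)%E.
  under [RHS]eq_integral do rewrite EFinM.
  by rewrite ge0_integralZl_EFin// invr_ge0 ltW.
rewrite lee_wpmul2l ?lee_fin//; apply: ge0_integral_le.
- exact: emeasurable_sum.
- by apply/measurable_EFinP; apply: measurable_funM => //; exact: measurable_funX.
- by move=> y; exact: sume_ge0.
- move=> y; rewrite sumEFin lee_fin.
  apply: (@le_trans _ _ (\sum_(m < M.+1) annulus m y * (W y * g y ^+ 2))).
    apply: ler_sum => m _; rewrite exprMn annulus_sqr annulusE.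
    case: (boolP (lam y \in band m)) => [/qW qm|_]; rewrite ?mul1r ?mul0r ?mulr0//.
    by rewrite ler_wpM2r// sqr_ge0.
  (* The bands are disjoint: the indicators add up to at most 1, and [W y * g y ^+ 2] is counted at
     most once. *)
  rewrite -mulr_suml sum_annulus.
  have Wg : 0 <= W y * g y ^+ 2 by rewrite mulr_ge0 ?sqr_ge0.
  by case: (lam y <= _); rewrite ?mul1r ?mul0r.
Qed.

End annuli.

End dyadic_frequencies.

(** * Removing the truncations *)

Section truncated_integrals.
Context d (X : measurableType d) (R : realType).
Variable mu : {measure set X -> \bar R}.

(** If the positive or the negative part has infinite integral, the difference is infinite, even
    when both have, and [fine] returns its default value 0. *)
Lemma Rintegral_nonintegrable (h : X -> R) : measurable_fun setT h ->
  ~ mu.-integrable setT (EFin \o h) -> \int[mu]_x h x = 0.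
Proof.
move=> mh nih; have mE : measurable_fun setT (EFin \o h) by exact/measurable_EFinP.
rewrite /Rintegral integralE.
set p := (\int[mu]_x (EFin \o h)^\+ x)%E; set q := (\int[mu]_x (EFin \o h)^\- x)%E.
have p0 : (0 <= p)%E by apply: integral_ge0 => x _; exact: funepos_ge0.
have q0 : (0 <= q)%E by apply: integral_ge0 => x _; exact: funeneg_ge0.
have : ~ (p < +oo /\ q < +oo)%E.
  move=> [poo qoo]; apply: nih; apply/integrableP; split => //.
  under eq_integral do rewrite -/((abse \o (EFin \o h)) _) fune_abse.
  rewrite ge0_integralD//; last 2 first.
  - exact: measurable_funepos.
  - exact: measurable_funeneg.
  exact: lte_add_pinfty.
rewrite -/p -/q; move: p q p0 q0 => [p| |] [q| |]//= _ _ h2.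
by exfalso; apply: h2; rewrite !ltry.
Qed.

Lemma Rintegral_truncation_cvg (h : X -> R) (chi : nat -> X -> R) :
  (forall k, measurable_fun setT (chi k)) -> (forall k x, 0 <= chi k x <= 1) ->
  (forall x, \forall k \near \oo, chi k x = 1) ->
  mu.-integrable setT (EFin \o h) ->
  \int[mu]_x (chi k x * h x) @[k --> \oo] --> \int[mu]_x h x.
Proof.
move=> mchi chi01 chi1 ih; have [mE hoo] := integrableP _ _ _ ih.
have mh : measurable_fun setT h by exact/measurable_EFinP.
have habs : mu.-integrable setT (fun x => `|h x|%:E) by exact: (integrable_norm ih).
have mf k : measurable_fun setT (fun x => (chi k x * h x)%:E).
  by apply/measurable_EFinP; exact: measurable_funM.
have cf : {ae mu, forall x, setT x ->
    (fun k => (chi k x * h x)%:E) @ \oo --> (EFin \o h) x}.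
  apply: aeW => x _; apply: cvg_near_cst.
  by apply: filterS (chi1 x) => k -> /=; rewrite mul1r.
have hf : {ae mu, forall x k, setT x -> (`|(chi k x * h x)%:E| <= `|h x|%:E)%E}.
  apply: aeW => x k _; rewrite lee_fin normrM ler_piMl//.
  by have /andP[? ?] := chi01 k x; rewrite ger0_norm.
have [_ _ cv] := dominated_convergence measurableT mf mE cf habs hf.
apply: fine_cvg; rewrite EFin_Rintegral//; exact: cv.
Qed.

End truncated_integrals.

Section flow_rV.
Context (R : realType) (n : nat) (a : R).
Local Notation mu := (lebesgue_rV R n).
Local Notation phi := (@dotv R n).
Local Notation C := ((40 * pi) ^+ n : R).

Definition dispersion (xi : 'rV[R]_n) : R := enorm xi `^ a.

Lemma measurable_dispersion : measurable_fun setT dispersion.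
Proof.
exact: (measurableT_comp (@measurable_powR R a) (@measurable_enorm R n)).
Qed.

Variables (u v : 'rV[R]_n -> R) (c1 c2 : R).
Hypotheses (mu_ : measurable_fun setT u) (mv : measurable_fun setT v).

(** One shape for both parts of e^(iA) (u + i v). The real part is cos A u - sin A v, with sin A =
    cos (A - pi/2). The imaginary part is cos A v + sin A u, with sin A = - cos (A + pi/2) and u, v
    exchanged. *)
Definition wave t x xi : R :=
  cos (phi x xi + (t * dispersion xi + c1)) * u xi -
  cos (phi x xi + (t * dispersion xi + c2)) * v xi.

(** The cutoffs to a box and to bounded values of [u] and [v] make the amplitudes tame; the cutoff
    of the dispersion leaves finitely many bands. *)
Let chi (k : nat) xi : R := box k.+1%:R xi *
  (box1 k.+1%:R (u xi) * box1 k.+1%:R (v xi)) *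
  \1_`]-oo, 2 ^+ k] (dispersion xi).

Let chi_01 k xi : 0 <= chi k xi <= 1.
Proof.
have /andP[? ?] := box_01 k.+1%:R xi; have /andP[? ?] := box1_01 k.+1%:R (u xi).
have /andP[? ?] := box1_01 k.+1%:R (v xi).
have ? : 0 <= (\1_`]-oo, 2 ^+ k] (dispersion xi) : R) by rewrite indicE.
have ? : (\1_`]-oo, 2 ^+ k] (dispersion xi) : R) <= 1 by rewrite indicE; case: (_ \in _).
by rewrite /chi !(mulr_ge0, mulr_ile1).
Qed.

Let measurable_chi k : measurable_fun setT (chi k).
Proof.
apply: measurable_funM; last first.
  exact: (measurableT_comp (measurable_itv_indic _) measurable_dispersion).
apply: measurable_funM; first exact: measurable_box.
by apply: measurable_funM; apply: (measurableT_comp (measurable_box1 _)).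
Qed.

Let chi_eq1 xi : \forall k \near \oo, chi k xi = 1.
Proof.
near=> k.
have le_k (r : R) : r <= k%:R -> r <= k.+1%:R by move/le_trans; apply; rewrite ler_nat.
rewrite /chi box_eq1; last first.
  move=> i; apply: le_k; apply: (@le_trans _ _ (\sum_j `|xi ord0 j|)).
    by rewrite (bigD1 i)//= lerDl sumr_ge0.
  by near: k; exact: nbhs_infty_ger.
have -> : box1 k.+1%:R (u xi) = 1.
  rewrite box1E -ler_norml le_k//; near: k; exact: nbhs_infty_ger.
have -> : box1 k.+1%:R (v xi) = 1.
  rewrite box1E -ler_norml le_k//; near: k; exact: nbhs_infty_ger.
rewrite indicE mem_setE in_itv /= (_ : _ <= _) ?mulr1//.
apply: (@le_trans _ _ k%:R); first by near: k; exact: nbhs_infty_ger.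
by rewrite -natrX ler_nat ltnW// ltn_expl.
Unshelve. all: by end_near. Qed.

Let chi_sqr_le k xi : chi k xi ^+ 2 <= 1.
Proof. by have /andP[? ?] := chi_01 k xi; rewrite exprn_ile1. Qed.

Let tame_chi k (w : 'rV[R]_n -> R) : measurable_fun setT w ->
  (forall xi, chi k xi * `|w xi| <= k.+1%:R * box k.+1%:R xi) ->
  tame (box k.+1%:R) (fun xi => chi k xi * w xi).
Proof.
move=> mw hw; split; first exact: measurable_funM.
exists k.+1%:R => xi; have /andP[? _] := chi_01 k xi.
by rewrite normrM ger0_norm.
Qed.

Let box1_norm_le (k r : R) : box1 k r * `|r| <= k * box1 k r.
Proof.
rewrite box1E -ler_norml; case: (boolP (`|r| <= k)) => h.
  by rewrite mul1r mulr1.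
by rewrite mul0r mulr0.
Qed.

Let mulr_box_le (x y z w r k : R) : 0 <= x -> 0 <= z <= 1 -> 0 <= w <= 1 ->
  y * r <= k * y -> 0 <= y <= 1 -> 0 <= k -> 0 <= r -> x * (y * z) * w * r <= k * x.
Proof.
move=> x0 /andP[z0 z1] /andP[w0 w1] yr /andP[y0 y1] k0 r0.
rewrite (_ : _ * r = x * (z * w * (y * r))); last by ring.
rewrite [leRHS]mulrC ler_wpM2l//.
apply: (@le_trans _ _ (y * r)).
  by rewrite ler_piMl ?mulr_ge0// mulr_ile1.
by apply: le_trans yr _; rewrite ler_piMr.
Qed.

Let chi_u k : tame (box k.+1%:R) (fun xi => chi k xi * u xi).
Proof.
apply: tame_chi => // xi; have /andP[? _] := box_01 k.+1%:R xi.
apply: mulr_box_le => //; try exact: box1_01.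
- by rewrite indicE; case: (_ \in _); rewrite ?lexx ?ler01.
Qed.

Let chi_v k : tame (box k.+1%:R) (fun xi => chi k xi * v xi).
Proof.
apply: tame_chi => // xi; have /andP[? _] := box_01 k.+1%:R xi.
rewrite /chi [box1 _ (u xi) * _]mulrC.
apply: mulr_box_le => //; try exact: box1_01.
- by rewrite indicE; case: (_ \in _); rewrite ?lexx ?ler01.
Qed.

Let chi_high k (w : 'rV[R]_n -> R) xi : 2 ^+ k < dispersion xi -> chi k xi * w xi = 0.
Proof.
by move=> h; rewrite /chi indicE mem_setE in_itv /= leNgt h /= mulr0 mul0r.
Qed.

(** For each truncation the bound involves a partial sum, at most [S], and amplitudes reduced by
    [chi]; it is therefore uniform in k and survives the limit. The 32 is twice 16, from the square
    of a difference. *)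
Lemma dominated_wave (E : set R) (N : nat -> nat) (q : nat -> R)
    (W : 'rV[R]_n -> R) (S : R) :
  measurable_fun setT W -> (forall xi, 0 <= W xi) ->
  (forall m, 0 < q m) -> (forall m, (0 < N m)%N) ->
  (forall m, exists t0 : 'I_(N m) -> R,
    E `<=` \bigcup_l `[t0 l, t0 l + 2 ^- m]%classic) ->
  (forall m xi, dispersion xi \in band R m -> (q m)^-1 <= W xi) ->
  (forall M, \sum_(m < M) (N m)%:R * q m <= S) ->
  dominated mu (fun t x => \int[mu]_xi wave t x xi) E
    (S%:E * ((32 * C)%:E * (\int[mu]_xi (W xi * u xi ^+ 2)%:E +
       \int[mu]_xi (W xi * v xi ^+ 2)%:E)))%E.
Proof.
move=> mW W0 q0 N0 cover qW NS.
have C0 : 0 <= C by rewrite exprn_ge0// mulr_ge0// pi_ge0.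
have S0 : 0 <= S by have := NS 0%N; rewrite big_ord0.
have kpos k : 0 < k.+1%:R :> R by rewrite ltr0n.
have dpos xi : 0 <= dispersion xi by exact: powR_ge0.
have mdot := @measurable_dotv R n.
have mph t c : measurable_fun setT (fun xi => t * dispersion xi + c).
  by apply: measurable_funD => //; apply: measurable_funM => //; exact: measurable_dispersion.
have dom k c (w : 'rV[R]_n -> R) : measurable_fun setT w ->
    tame (box k.+1%:R) (fun xi => chi k xi * w xi) ->
    dominated mu (flow mu phi dispersion c (fun xi => chi k xi * w xi)) E
      (S%:E * ((16 * C)%:E * \int[mu]_xi (W xi * w xi ^+ 2)%:E))%E.
  move=> mw tw.
  (* [chi k] kills dispersions above 2^k, so the k + 1 bands up to [M := k] suffice. *)
  have := dominated_dyadic_sum mdot (window_box n k.+1%:R) C0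
    (@bessel_rV R n k.+1%:R (kpos k)) measurable_dispersion dpos c (M := k) tw
    (@chi_high k w) mW W0 q0 N0 cover qW.
  apply: dominated_le; apply: lee_pmul.
  - by rewrite lee_fin sumr_ge0// => m _; rewrite mulr_ge0// ltW.
  - rewrite mule_ge0 ?lee_fin ?mulr_ge0//; apply: integral_ge0 => xi _.
    by rewrite lee_fin mulr_ge0 ?sqr_ge0.
  - by rewrite lee_fin.
  - rewrite lee_wpmul2l ?lee_fin ?mulr_ge0//; apply: ge0_integral_le.
    + apply/measurable_EFinP; apply: measurable_funM => //; apply: measurable_funX.
      exact: tame_measurable tw.
    + by apply/measurable_EFinP; apply: measurable_funM => //; exact: measurable_funX.
    + by move=> xi; rewrite lee_fin mulr_ge0 ?sqr_ge0.
    + move=> xi; rewrite lee_fin ler_wpM2l// exprMn ler_piMl ?sqr_ge0//.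
pose I w := (\int[mu]_xi (W xi * w xi ^+ 2)%:E)%E.
have I0 w : (0 <= I w)%E.
  by apply: integral_ge0 => xi _; rewrite lee_fin mulr_ge0 ?sqr_ge0.
rewrite -/(I u) -/(I v).
have -> : (S%:E * ((32 * C)%:E * (I u + I v)) =
    2%:E * (S%:E * ((16 * C)%:E * I u)) + 2%:E * (S%:E * ((16 * C)%:E * I v)))%E.
  rewrite ge0_muleDr// ge0_muleDr ?mule_ge0 ?lee_fin ?mulr_ge0//.
  rewrite !muleA -!EFinM; congr (_%:E * _ + _%:E * _)%E; ring.
apply: (@dominated_lim _ _ _ _ _ (fun k t x =>
  flow mu phi dispersion c1 (fun xi => chi k xi * u xi) t x -
  flow mu phi dispersion c2 (fun xi => chi k xi * v xi) t x)).
  by move=> k; apply: dominatedB; apply: dom.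
move=> t x _.
have mwave : measurable_fun setT (wave t x).
  apply: measurable_funB; apply: measurable_funM => //; apply: measurable_fun_cos;
    apply: measurable_funD => //; exact: (jointly_measurable1 x mdot).
have [iw|] := pselect (mu.-integrable setT (EFin \o wave t x)); last first.
  by move=> niw; right; exact: Rintegral_nonintegrable.
left.
have flowE k : flow mu phi dispersion c1 (fun xi => chi k xi * u xi) t x -
    flow mu phi dispersion c2 (fun xi => chi k xi * v xi) t x =
    \int[mu]_xi (chi k xi * wave t x xi).
  rewrite /flow /osc -RintegralB//.
  - by apply: eq_Rintegral => xi _; rewrite /wave; ring.
  - exact: (osc_integrable x (window_box n k.+1%:R) (chi_u k) mdot (mph t c1)).
  - exact: (osc_integrable x (window_box n k.+1%:R) (chi_v k) mdot (mph t c2)).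
under eq_cvg do rewrite flowE.
exact: Rintegral_truncation_cvg.
Qed.

End flow_rV.

(** * The propagator *)

Section complex_parts.
Context (R : realType).
Implicit Types z w : R[i].

Lemma ReM z w : complex.Re (z * w) =
  complex.Re z * complex.Re w - complex.Im z * complex.Im w.
Proof. by case: z; case: w. Qed.

Lemma ImM z w : complex.Im (z * w) =
  complex.Re z * complex.Im w + complex.Im z * complex.Re w.
Proof. by case: z; case: w. Qed.

Lemma expiD (alpha beta : R) : expi alpha * expi beta = expi (alpha + beta).
Proof.
by apply/eqP; rewrite eq_complex ReM ImM /= cosD sinD [X in _ && (_ == X)]addrC !eqxx.
Qed.

Lemma sqr_modulus z : modulus z ^+ 2 = complex.Re z ^+ 2 + complex.Im z ^+ 2.
Proof. by rewrite /modulus normc_def /= sqr_sqrtr// addr_ge0// sqr_ge0. Qed.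

Lemma modulus_ge0 z : 0 <= modulus z.
Proof. by rewrite /modulus normc_def /= sqrtr_ge0. Qed.

End complex_parts.

Section fourier_rV.
Context (R : realType) (n : nat).
Local Notation mu := (lebesgue_rV R n).
Implicit Types (f : 'rV[R]_n -> R[i]) (x xi : 'rV[R]_n).

Lemma dotvC x xi : dotv x xi = dotv xi x.
Proof. by apply: eq_bigr => i _; rewrite mulrC. Qed.

Lemma measurable_real_schwartz (g : 'rV[R]_n -> R) : real_schwartz g ->
  measurable_fun setT g.
Proof.
move=> [dg _]; apply: continuous_measurable_rV => x.
exact: differentiable_continuous (dg [::] x).
Qed.

Lemma measurable_fourier f : schwartz f ->
  measurable_fun setT (fun xi => complex.Re (fourier f xi)) /\
  measurable_fun setT (fun xi => complex.Im (fourier f xi)).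
Proof.
move=> [/measurable_real_schwartz mRe /measurable_real_schwartz mIm].
have mN : measurable_fun setT (fun z : 'rV[R]_n * 'rV[R]_n => - dotv z.1 z.2).
  apply: (measurableT_comp (@oppr_measurable R setT)); exact: measurable_dotv.
have mRe2 : measurable_fun setT (fun z : 'rV[R]_n * 'rV[R]_n => complex.Re (f z.2)).
  exact: measurableT_comp mRe measurable_snd.
have mIm2 : measurable_fun setT (fun z : 'rV[R]_n * 'rV[R]_n => complex.Im (f z.2)).
  exact: measurableT_comp mIm measurable_snd.
split; rewrite /fourier /integralC /=.
- apply: (@measurable_Rintegral _ _ _ _ _ mu
    (fun xi x => complex.Re (expi (- dotv xi x) * f x))).
  rewrite /jointly_measurable; under eq_fun do rewrite ReM /=.
  apply: measurable_funB; apply: measurable_funM => //.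
    exact: measurable_fun_cos.
  exact: measurable_fun_sin.
- apply: (@measurable_Rintegral _ _ _ _ _ mu
    (fun xi x => complex.Im (expi (- dotv xi x) * f x))).
  rewrite /jointly_measurable; under eq_fun do rewrite ImM /=.
  apply: measurable_funD; apply: measurable_funM => //.
    exact: measurable_fun_cos.
  exact: measurable_fun_sin.
Qed.

(** The phases of the two exponentials add up; the real and imaginary parts of the inversion
    integral are two waves with [u] and [v] exchanged. *)
Lemma sqr_modulus_propagator a t f x :
  let u xi := complex.Re (fourier f xi) in
  let v xi := complex.Im (fourier f xi) in
  modulus (propagator a t f x) ^+ 2 = ((2 * pi) ^- n) ^+ 2 *
    ((\int[mu]_xi wave a u v 0 (- (pi / 2)) t x xi) ^+ 2 +
     (\int[mu]_xi wave a v u 0 (pi / 2) t x xi) ^+ 2).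
Proof.
move=> u v; set P := \int[mu]_xi _; set Q := \int[mu]_xi _.
have -> : propagator a t f x = (((2 * pi) ^- n)%:C * (P +i* Q))%C.
  rewrite /propagator; congr (_ * _); rewrite /integralC.
  congr (_ +i* _)%C; apply: eq_Rintegral => xi _.
  - by rewrite expiD ReM /wave addr0 addrA cosBpihalf (dotvC x xi).
  - rewrite expiD ImM /wave addr0 addrA cosDpihalf (dotvC x xi) mulNr opprK.
    by [].
clearbody P Q; by rewrite sqr_modulus ReM ImM /= !mul0r subr0 addr0 !exprMn -mulrDr.
Qed.

End fourier_rV.

(** * Covering numbers *)

Section covering_numbers.
Context (R : realType).
Implicit Types (E : set R) (r : R).

(** An infimum of natural numbers is attained as soon as a finite cover exists; otherwise it is the
    infimum of the empty set. *)
Lemma covering_numberP E r :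
  covering_number E r = +oo%E \/
  exists2 N, coverable E r N & covering_number E r = N%:R%:E.
Proof.
have [[N0 cN0]|nc] := pselect (exists N, coverable E r N); last first.
  left; apply/ereal_inf_pinfty => y [N cN _]; exfalso; apply: nc; by exists N.
right; have ex : exists N, `[< coverable E r N >] by exists N0; exact/asboolP.
case: (ex_minnP ex) => N /asboolP cN minN; exists N => //.
apply/eqP; rewrite eq_le; apply/andP; split.
- by apply: ereal_inf_lbound; exists N.
- apply: le_ereal_inf_tmp => _ [k /asboolP ck <-].
  by rewrite lee_fin ler_nat minN.
Qed.

Lemma covering_number_ge0 E r : (0 <= covering_number E r)%E.
Proof. by apply: le_ereal_inf_tmp => _ [k _ <-]; rewrite lee_fin. Qed.

Lemma coverable_gt0 E r N : E !=set0 -> coverable E r N -> (0 < N)%N.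
Proof.
move=> [t Et] [I [_ /(_ t Et) [l _ _]]].
by case: N I l => // I [].
Qed.

(** Each of the four kinds of interval lies in the closed one with the same endpoints, the form used
    by the estimate in time. *)
Lemma coverable_closed E r N : coverable E r N ->
  exists t0 : 'I_N -> R, E `<=` \bigcup_l `[t0 l, t0 l + r]%classic.
Proof.
move=> [I [HI EI]].
have /choice[t0 ht0] : forall l, exists c, I l `<=` `[c, c + r]%classic.
  move=> l; have [c [bl [br ->]]] := HI l; exists c => s /=.
  by case: bl; case: br; rewrite !in_itv /= => /andP[h1 h2];
    rewrite ?(ltW h1) ?(ltW h2) ?h1 ?h2.
by exists t0 => s /EI [l _ /ht0 h]; exists l.
Qed.

End covering_numbers.

(** * The maximal estimate *)

Section maximal_estimates.
Context (R : realType) (n : nat) (a s : R).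
Hypotheses (ha : 0 < a) (hs : 0 < s).
Local Notation mu := (lebesgue_rV R n).

Definition bessel_weight (xi : 'rV[R]_n) : R := (1 + enorm xi ^+ 2) `^ s.

Lemma bessel_weight_gt0 xi : 0 < bessel_weight xi.
Proof. by apply: powR_gt0; rewrite ltr_pwDl// sqr_ge0. Qed.

Lemma measurable_bessel_weight : measurable_fun setT bessel_weight.
Proof.
apply: (measurableT_comp (@measurable_powR R s)); apply: measurable_funD => //.
by apply: measurable_funX; exact: measurable_enorm.
Qed.

(** For m > 0 the band gives 2^(m-1) < |xi|^a, hence 2^((m-1) 2s/a) <= |xi|^(2s); the shift of the
    index costs the factor 2^(2s/a). On band 0 it is enough that the weight is at least 1. *)
Lemma dyadic_weight_le m xi : dispersion a xi \in band R m ->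
  (2 `^ (- (2 * m%:R * s / a)))^-1 <= 2 `^ (2 * s / a) * bessel_weight xi.
Proof.
have e0 : 0 <= enorm xi by exact: sqrtr_ge0.
have sa0 : 0 <= 2 * s / a by rewrite !mulr_ge0 ?invr_ge0// ltW.
have one z : 1 `^ z = 1 :> R by rewrite powR1.
have w1 : 1 <= bessel_weight xi.
  rewrite -(one s); apply: ge0_ler_powR; rewrite ?nnegrE ?(ltW hs)//.
    by rewrite addr_ge0// sqr_ge0.
  by rewrite lerDl sqr_ge0.
have d1 : 1 <= 2 `^ (2 * s / a) :> R.
  by rewrite -[leLHS](one (2 * s / a)); apply: ge0_ler_powR; rewrite ?nnegrE ?ler1n.
rewrite powRN invrK; case: m => [_|m /=].
  by rewrite mulr0 !mul0r powRr0 mulr_ege1.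
rewrite in_itv /= => /andP[lm _].
have -> : 2 * m.+1%:R * s / a = 2 * s / a + m%:R * (2 * s / a).
  by rewrite -natr1; field; rewrite gt_eqF.
rewrite powRD; last by rewrite pnatr_eq0 implybT.
rewrite ler_wpM2l ?powR_ge0// powRrM powR_mulrn//.
apply: (@le_trans _ _ (dispersion a xi `^ (2 * s / a))).
  by apply: ge0_ler_powR => //; rewrite ?nnegrE ?exprn_ge0 ?powR_ge0// ltW.
rewrite /dispersion -powRrM (_ : a * (2 * s / a) = 2%:R * s); last first.
  by field; rewrite gt_eqF.
rewrite powRrM powR_mulrn//; apply: ge0_ler_powR; rewrite ?nnegrE ?(ltW hs)//.
- exact: sqr_ge0.
- by rewrite addr_ge0// sqr_ge0.
- by rewrite lerDr.
Qed.

Lemma sqr_sobolev_norm f : (sobolev_norm s f ^+ 2 =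
  \int[mu]_xi (bessel_weight xi * modulus (fourier f xi) ^+ 2)%:E)%E.
Proof.
rewrite /sobolev_norm; set I := (\int[mu]_xi _)%E.
have I0 : (0 <= I)%E.
  by apply: integral_ge0 => xi _; rewrite lee_fin mulr_ge0 ?sqr_ge0 ?powR_ge0.
rewrite poweR12_sqrt// expe2; move: I I0 => [r| |]//= r0.
by rewrite -EFinM -expr2 sqr_sqrtr.
Qed.

(** The bound is moved under a square root to pass through the supremum. Since [E] is nonempty the
    supremum is nonnegative; over the empty set it would be [-oo], with square [+oo]. *)
Lemma sqr_ereal_sup_le (T : Type) (E : set T) (F : T -> R) (h : \bar R) :
  E !=set0 -> (forall t, 0 <= F t) ->
  (forall t, E t -> ((F t ^+ 2)%:E <= h)%E) ->
  (ereal_sup [set (F t)%:E | t in E] ^+ 2 <= h)%E.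
Proof.
move=> [t0 Et0] F0 Fh.
have sup0 : (0 <= ereal_sup [set (F t)%:E | t in E])%E.
  apply: (@le_trans _ _ (F t0)%:E); first by rewrite lee_fin.
  by apply: ereal_sup_ubound; exists t0.
case: h Fh => [r| |] Fh.
- have r0 : 0 <= r by have := Fh _ Et0; rewrite lee_fin; apply: le_trans; rewrite sqr_ge0.
  have supr : (ereal_sup [set (F t)%:E | t in E] <= (Num.sqrt r)%:E)%E.
    apply: ge_ereal_sup => _ [t Et <-]; rewrite lee_fin.
    rewrite -[F t]ger0_norm// -sqrtr_sqr ler_sqrt//.
    by have := Fh t Et; rewrite lee_fin.
  rewrite expe2; apply: le_trans (lee_pmul sup0 sup0 supr supr) _.
  by rewrite -EFinM lee_fin -expr2 sqr_sqrtr.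
- exact: leey.
- by have := Fh t0 Et0.
Qed.

(** (2 pi)^(-2n) is the squared normalisation of the inverse transform, 64 is 32 for each of the
    real and imaginary parts, (40 pi)^n is the Bessel constant, and 2^(2s/a) is the loss at the
    lower end of a band. *)
Definition maximal_constant : R :=
  ((2 * pi) ^- n) ^+ 2 * (64 * (40 * pi) ^+ n) * 2 `^ (2 * s / a).

Lemma maximal_constant_gt0 : 0 < maximal_constant.
Proof.
have p0 : 0 < pi :> R by exact: pi_gt0.
by rewrite !mulr_gt0 ?powR_gt0 ?exprn_gt0 ?invr_gt0 ?exprn_gt0 ?mulr_gt0.
Qed.

Section fixed_data.
Variables (E : set R) (f : 'rV[R]_n -> R[i]).
Hypotheses (E0 : E !=set0) (sf : schwartz f).

Let u xi := complex.Re (fourier f xi).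
Let v xi := complex.Im (fourier f xi).
Let I := (\int[mu]_xi (bessel_weight xi * modulus (fourier f xi) ^+ 2)%:E)%E.

Let measurable_u : measurable_fun setT u.
Proof. by have [] := measurable_fourier sf. Qed.

Let measurable_v : measurable_fun setT v.
Proof. by have [] := measurable_fourier sf. Qed.

Let modE xi : modulus (fourier f xi) ^+ 2 = u xi ^+ 2 + v xi ^+ 2.
Proof. exact: sqr_modulus. Qed.

Let measurable_mod : measurable_fun setT
  (fun xi => (bessel_weight xi * modulus (fourier f xi) ^+ 2)%:E).
Proof.
apply/measurable_EFinP; apply: measurable_funM; first exact: measurable_bessel_weight.
under eq_fun do rewrite modE.
by apply: measurable_funD; exact: measurable_funX.
Qed.

Lemma maximal_propagator_ge0 x : (0 <= maximal_propagator a E f x)%E.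
Proof.
have [t Et] := E0; apply: (@le_trans _ _ (modulus (propagator a t f x))%:E).
  by rewrite lee_fin modulus_ge0.
by apply: ereal_sup_ubound; exists t.
Qed.

Lemma sqr_maximal_propagator_ge0 x : (0 <= maximal_propagator a E f x ^+ 2)%E.
Proof. by rewrite expe2 mule_ge0// maximal_propagator_ge0. Qed.

(** Covers a vanishing norm with a divergent series, where the right side is [+oo * 0 = 0]. The
    transform is then 0 almost everywhere, so every inversion integral vanishes. *)
Lemma maximal_propagator_null : I = 0%E ->
  (\int[mu]_x (maximal_propagator a E f x ^+ 2) = 0)%E.
Proof.
move=> Ieq0.
have null : {ae mu, forall xi, u xi = 0 /\ v xi = 0}.
  have /(ae_eq_integral_abs mu measurableT measurable_mod) : (\int[mu]_xi
      `|(bessel_weight xi * modulus (fourier f xi) ^+ 2)%:E| = 0)%E.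
    rewrite -Ieq0; apply: eq_integral => xi _; rewrite gee0_abs// lee_fin.
    by rewrite mulr_ge0 ?sqr_ge0// ltW// bessel_weight_gt0.
  apply: filterS => xi /(_ Logic.I) [] /eqP.
  rewrite mulf_eq0 gt_eqF ?bessel_weight_gt0//= modE paddr_eq0 ?sqr_ge0//.
  by rewrite !sqrf_eq0 => /andP[/eqP -> /eqP ->].
have int0 (g h : 'rV[R]_n -> R) c1 c2 t x : {ae mu, forall xi, g xi = 0 /\ h xi = 0} ->
    measurable_fun setT g -> measurable_fun setT h ->
    \int[mu]_xi wave a g h c1 c2 t x xi = 0.
  move=> gh0 mg mh; rewrite /Rintegral (ae_eq_integral (cst 0%E))//.
  - by rewrite integral0.
  - apply/measurable_EFinP; apply: measurable_funB; apply: measurable_funM => //;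
      apply: measurable_fun_cos; apply: measurable_funD;
      try exact: (jointly_measurable1 x (@measurable_dotv R n));
      apply: measurable_funD => //; apply: measurable_funM => //;
      exact: measurable_dispersion.
  - by apply: filterS gh0 => xi [gx hx] _; rewrite /wave gx hx !mulr0 subr0.
apply/eqP; rewrite eq_le; apply/andP; split; last first.
  by apply: integral_ge0 => x _; exact: sqr_maximal_propagator_ge0.
rewrite -[leRHS](integral0 mu setT).
(* Measurability of the maximal function is not established, so the comparison rests on monotonicity
   of the integral for arbitrary nonnegative functions. *)
apply: ge0_nonmeasurable_integral_le; first exact: sqr_maximal_propagator_ge0.
move=> x; apply: sqr_ereal_sup_le => // [t|t _]; first exact: modulus_ge0.
rewrite sqr_modulus_propagator !int0//; first by rewrite expr0n addr0 mulr0.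
by apply: filterS null => xi [? ?].
Qed.

(** The real and imaginary parts have separate majorants [H1] and [H2]. [W] contains the factor lost
    at the lower end of the bands, so [J u + J v] is 2^(2s/a) times the squared Sobolev norm. *)
Lemma maximal_propagator_finite (N : nat -> nat) (S : R) :
  (forall m, coverable E (2 ^- m) (N m)) ->
  (forall M, \sum_(m < M) (N m)%:R * 2 `^ (- (2 * m%:R * s / a)) <= S) ->
  (\int[mu]_x (maximal_propagator a E f x ^+ 2) <=
   maximal_constant%:E * S%:E * I)%E.
Proof.
move=> cN NS.
pose W xi := 2 `^ (2 * s / a) * bessel_weight xi.
have mW : measurable_fun setT W.
  by apply: measurable_funM => //; exact: measurable_bessel_weight.
have W0 xi : 0 <= W xi by rewrite mulr_ge0 ?powR_ge0.
have C0 : 0 <= (40 * pi) ^+ n :> R by rewrite exprn_ge0// mulr_ge0// pi_ge0.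
have S0 : 0 <= S by have := NS 0%N; rewrite big_ord0.
have N0 m : (0 < N m)%N by exact: coverable_gt0 E0 (cN m).
have q0 (m : nat) : 0 < 2 `^ (- (2 * m%:R * s / a)) :> R by exact: powR_gt0.
have cover m := coverable_closed (cN m).
pose J (g : 'rV[R]_n -> R) := (\int[mu]_xi (W xi * g xi ^+ 2)%:E)%E.
have m2 (g : 'rV[R]_n -> R) : measurable_fun setT g ->
    measurable_fun setT (fun xi => (W xi * g xi ^+ 2)%:E).
  by move=> mg; apply/measurable_EFinP; apply: measurable_funM => //; exact: measurable_funX.
have JE : (J u + J v = (2 `^ (2 * s / a))%:E * I)%E.
  rewrite /J /I -ge0_integralD//; try exact: m2; last 2 first.
  - by move=> xi _; rewrite lee_fin mulr_ge0// sqr_ge0.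
  - by move=> xi _; rewrite lee_fin mulr_ge0// sqr_ge0.
  rewrite -ge0_integralZl_EFin ?powR_ge0//; last first.
    by move=> xi _; rewrite lee_fin mulr_ge0 ?sqr_ge0// ltW// bessel_weight_gt0.
  by apply: eq_integral => xi _; rewrite -EFinD -EFinM modE /W; congr EFin; ring.
have [H1 [mH1 H10 PH1 H1le]] := dominated_wave 0 (- (pi / 2))
  measurable_u measurable_v mW W0 q0 N0 cover dyadic_weight_le NS.
have [H2 [mH2 H20 PH2 H2le]] := dominated_wave 0 (pi / 2)
  measurable_v measurable_u mW W0 q0 N0 cover dyadic_weight_le NS.
pose k : R := ((2 * pi) ^- n) ^+ 2.
have k0 : 0 <= k by exact: sqr_ge0.
apply: (@le_trans _ _ (\int[mu]_x (k%:E * (H1 x + H2 x)))%E).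
  apply: ge0_nonmeasurable_integral_le; first exact: sqr_maximal_propagator_ge0.
  move=> x; apply: sqr_ereal_sup_le => // [t|t Et]; first exact: modulus_ge0.
  rewrite sqr_modulus_propagator EFinM EFinD lee_wpmul2l ?lee_fin//.
  by apply: leeD; [exact: PH1|exact: PH2].
rewrite ge0_integralZl_EFin//; last 2 first.
- by move=> x _; rewrite adde_ge0.
- exact: emeasurable_funD.
rewrite ge0_integralD//.
apply: (@le_trans _ _ (k%:E * (S%:E * ((32 * (40 * pi) ^+ n)%:E * (J u + J v)) +
    S%:E * ((32 * (40 * pi) ^+ n)%:E * (J v + J u))))%E).
  by apply: lee_wpmul2l; [rewrite lee_fin|exact: leeD H1le H2le].
have I0 : (0 <= I)%E.
  by apply: integral_ge0 => xi _; rewrite lee_fin mulr_ge0 ?sqr_ge0// ltW// bessel_weight_gt0.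
rewrite [(J v + J u)%E]addeC JE !muleA -!EFinM.
rewrite -ge0_muleDl ?lee_fin ?mulr_ge0 ?powR_ge0// muleA -EFinD -EFinM.
rewrite le_eqVlt; apply/orP; left; apply/eqP; congr (_%:E * _)%E.
by rewrite /maximal_constant -/k; ring.
Qed.

End fixed_data.

End maximal_estimates.

Theorem theorem4 (R : realType) (n : nat) (a s : R)
    (hn : (1 <= n)%N) (ha : 0 < a) (hs : 0 < s) :
  exists C : R, forall (E : set R) (f : 'rV[R]_n -> R[i]),
    E !=set0 -> bounded_set E -> schwartz f ->
    (\int[lebesgue_rV R n]_x (maximal_propagator a E f x ^+ 2) <=
       C%:E *
       (\sum_(0 <= m <oo)
          covering_number E (2 ^- m) * (2 `^ (- (2 * m%:R * s / a)))%:E) *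
       sobolev_norm s f ^+ 2)%E.
Proof.
exists (maximal_constant n a s) => E f E0 _ sf.
have C0 := maximal_constant_gt0 n a s.
rewrite sqr_sobolev_norm; set I := (\int[_]_xi (bessel_weight s xi * _)%:E)%E.
have I0 : (0 <= I)%E.
  by apply: integral_ge0 => xi _; rewrite lee_fin mulr_ge0 ?sqr_ge0 ?powR_ge0.
have q0 (m : nat) : 0 < 2 `^ (- (2 * m%:R * s / a)) :> R by exact: powR_gt0.
set S := (\sum_(0 <= m <oo) _)%E.
have t0 (m : nat) : (0 <= covering_number E (2 ^- m) *
    (2 `^ (- (2 * m%:R * s / a)))%:E)%E.
  by rewrite mule_ge0 ?covering_number_ge0// lee_fin ltW.
have partial M : (\sum_(0 <= m < M) covering_number E (2 ^- m) *
    (2 `^ (- (2 * m%:R * s / a)))%:E <= S)%E.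
  by apply: nneseries_lim_ge => m _ _; exact: t0.
have S0 : (0 <= S)%E by apply: nneseries_ge0 => m _ _; exact: t0.
(* A zero norm is treated before a divergent series because [+oo * 0 = 0]. *)
have [In0|Ipos] := eqVneq I 0%E.
  by rewrite (maximal_propagator_null a E0 sf In0) In0 mule0.
(* With a positive norm, a divergent series makes the right side [+oo]. *)
have [Soo|Sfin] := eqVneq S +oo%E.
  by rewrite Soo gt0_muley ?lte_fin// gt0_mulye ?leey// lt0e Ipos.
have SE : S = (fine S)%:E.
  by rewrite fineK// ge0_fin_numE// lt_neqAle Sfin leey.
(* Each covering number has a positive coefficient in a convergent series of nonnegative terms, so
   none of them is infinite. *)
have cov m : exists N, coverable E (2 ^- m) N /\ covering_number E (2 ^- m) = N%:R%:E.
  have [coo|[N cN NE]] := covering_numberP E (2 ^- m); last by exists N.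
  exfalso; move: (partial m.+1); rewrite big_nat_recr//= coo gt0_mulye ?lte_fin//.
  rewrite addey; last first.
    by rewrite gt_eqF// (@lt_le_trans _ _ 0%E)// sume_ge0.
  by rewrite leye_eq (negbTE Sfin).
have /choice[N hN] := cov.
rewrite SE; apply: (maximal_propagator_finite ha hs E0 sf (N := N)).
  by move=> m; have [] := hN m.
move=> M; rewrite -lee_fin -SE; apply: le_trans (partial M).
rewrite big_mkord -sumEFin; apply: lee_sum => m _.
by have [_ ->] := hN m; rewrite EFinM.
Qed.
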